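(* Let $k$ be an algebraically closed field of characteristic $0$ and let $X$ be an affine normal $SL_2$-variety over $k$ with an open dense $SL_2$-orbit. Assume that $X$ is not a homogeneous $SL_2$-variety, and that the ring $k[X]^{\overline{U}}$ has (Krull) dimension $1$. Then $X$ is spherical. In particular, $X$ is $SL_2$-equivariantly isomorphic to $SL_2/\!/(\mu_f\ltimes\overline{U})=\mathrm{Spec}\left(R_\infty^{(f)}\right)$ for a unique positive integer $f$.
   Context: An $SL_2$-variety is a variety over $k$ with a left action of the algebraic group $SL_2$; $SL_2$ acts on $k[X]$ by $(g\cdot f)(x)=f(g^{-1}x)$. $T=\left\{\begin{bmatrix} t^{-1}&0\\0&t\end{bmatrix}\right\}$, $\overline{B}$ is the Borel subgroup of lower triangular matrices in $SL_2$, $\overline{U}$ is its unipotent radical, and $\mu_f\subset T$ is the $f$-torsion subgroup. An affine normal $SL_2$-variety is called spherical if it has a dense $\overline{B}$-orbit. Write $k[SL_2]=k[a,b,c,d]/(ad-bc-1)$, where $\begin{bmatrix} a&b\\c&d\end{bmatrix}$ is the generic matrix. For a positive integer $f$, $R_\infty^{(f)}=k[b^f,db^{f-1},d^2b^{f-2},\dots,d^f]\subset k[SL_2]$, with $SL_2$-action induced by the left regular representation $(g\cdot h)(x)=h(g^{-1}x)$. It equals the algebra of invariants of $\mu_f\ltimes\overline{U}\subset T\ltimes\overline{U}=\overline{B}$ acting on $k[SL_2]$ by the right regular representation $(g\cdot h)(x)=h(xg)$. *)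

(* Defs.v *)
From HB Require Import structures.
From mathcomp Require Import all_boot all_order all_algebra.
From mathcomp Require Import mathcomp_extra boolp classical_sets functions.
From mathcomp Require Import mpoly.

Set Implicit Arguments.
Unset Strict Implicit.
Unset Printing Implicit Defensive.

Import GRing.Theory.

Local Open Scope classical_set_scope.
Local Open Scope ring_scope.

Section KrullDimension.
Variable R : comNzRingType.

Definition prime_ideal (I : {pred R}) : Prop :=
  idealr_closed I /\ prime_idealr_closed I.

Definition prime_chain (n : nat) (P : nat -> {pred R}) : Prop :=
  (forall i, (i <= n)%N -> prime_ideal (P i)) /\
  (forall i, (i < n)%N ->
     {subset P i <= P i.+1} /\ exists2 x, x \in P i.+1 & x \notin P i).

Definition has_krull_dim (n : nat) : Prop :=
  (exists P, prime_chain n P) /\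
  (forall m P, prime_chain m P -> (m <= n)%N).

End KrullDimension.

Definition integrally_closed (A : idomainType) : Prop :=
  forall u : {fraction A}, integralOver (@tofrac A) u -> exists a, u = tofrac a.

#[short(type="idomainAlgType")]
HB.structure Definition IdomainAlgebra (R : nzRingType) :=
  {A of GRing.ComUnitAlgebra R A & GRing.IntegralDomain A}.

Definition finitely_generated (k : fieldType) (A : comAlgType k) : Prop :=
  exists (n : nat) (s : 'I_n -> A),
    forall h : A, exists P : {mpoly k[n]}, h = mmap (in_alg A) s P.

(* A set of points with a k-algebra acting on it as functions. *)
Record kspace (k : fieldType) := KSpace {
  kpoint :> Type;
  kcoord : comAlgType k;
  keval : kpoint -> {lrmorphism kcoord -> k^o}
}.

(* The k-points (closed points, when k is algebraically closed and A is
   finitely generated) of the spectrum of A. *)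
Definition Spec (k : fieldType) (A : comAlgType k) : kspace k :=
  @KSpace k {lrmorphism A -> k^o} A id.

(* An affine variety over an algebraically closed field k, seen through its
   k-points: k[X] is a finitely generated domain, its elements are functions
   on X (av_faithful), and X is recovered as the set of k-algebra morphisms
   k[X] -> k (av_points). *)
Record affineVariety (k : fieldType) := AffineVariety {
  avpoint : Type;
  avcoord : idomainAlgType k;
  aveval : avpoint -> {lrmorphism avcoord -> k^o};
  av_faithful : forall h h' : avcoord,
    (forall x, aveval x h = aveval x h') -> h = h';
  av_finitely_generated : finitely_generated avcoord;
  av_points : forall phi : {lrmorphism avcoord -> k^o},
    exists! x, aveval x =1 phi
}.

Coercion kspace_of_variety (k : fieldType) (X : affineVariety k) : kspace k :=
  KSpace (@aveval k X).

Definition normal_variety (k : fieldType) (X : affineVariety k) : Prop :=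
  integrally_closed (avcoord X).

Section Zariski.
Variables (k : fieldType) (X : kspace k).

Definition zariski_closed (Z : set X) : Prop :=
  exists S : set (kcoord X), Z = [set x | forall h, S h -> keval x h = 0].

Definition zariski_open (U : set X) : Prop := zariski_closed (~` U).

Definition zariski_dense (D : set X) : Prop :=
  forall Z, zariski_closed Z -> D `<=` Z -> Z = setT.

End Zariski.

Definition is_morphism (k : fieldType) (X Y : kspace k) (phi : X -> Y) : Prop :=
  forall h : kcoord Y, exists h' : kcoord X,
    forall x, keval x h' = keval (phi x) h.

Definition SL2 (k : fieldType) := {M : 'M[k]_2 | \det M == 1}.

HB.instance Definition _ (k : fieldType) := SubType.on (SL2 k).
HB.instance Definition _ (k : fieldType) := Choice.on (SL2 k).

Section SL2Group.
Variable k : fieldType.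
Implicit Types g h : SL2 k.

Lemma SL2_det g : \det (val g) = 1.
Proof. exact/eqP/(valP g). Qed.

Lemma SL2_unit g : val g \in unitmx.
Proof. by rewrite unitmxE SL2_det unitr1. Qed.

Fact SL2_one_subproof : \det (1%:M : 'M[k]_2) == 1.
Proof. by rewrite det1. Qed.
Definition SL2_one : SL2 k := Sub 1%:M SL2_one_subproof.

Fact SL2_mul_subproof g h : \det (val g *m val h) == 1.
Proof. by rewrite det_mulmx !SL2_det mulr1. Qed.
Definition SL2_mul g h : SL2 k := Sub (val g *m val h) (SL2_mul_subproof g h).

Fact SL2_inv_subproof g : \det (invmx (val g)) == 1.
Proof. by rewrite det_inv SL2_det invr1. Qed.
Definition SL2_inv g : SL2 k := Sub (invmx (val g)) (SL2_inv_subproof g).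

Fact SL2_mulA : associative SL2_mul.
Proof. by move=> x y z; apply: val_inj; rewrite /= mulmxA. Qed.
Fact SL2_mul1 : left_id SL2_one SL2_mul.
Proof. by move=> x; apply: val_inj; rewrite /= mul1mx. Qed.
Fact SL2_1mul : right_id SL2_one SL2_mul.
Proof. by move=> x; apply: val_inj; rewrite /= mulmx1. Qed.
Fact SL2_mulV : left_inverse SL2_one SL2_inv SL2_mul.
Proof. by move=> x; apply: val_inj; rewrite /= mulVmx ?SL2_unit. Qed.
Fact SL2_Vmul : right_inverse SL2_one SL2_inv SL2_mul.
Proof. by move=> x; apply: val_inj; rewrite /= mulmxV ?SL2_unit. Qed.

HB.instance Definition _ := isGroup.Build (SL2 k)
  SL2_mulA SL2_mul1 SL2_1mul SL2_mulV SL2_Vmul.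

HB.instance Definition _ := isPointed.Build (SL2 k) SL2_one.

(* The matrix g is [a b; c d]. *)
Definition ma g : k := val g 0 0.
Definition mb g : k := val g 0 1.
Definition mc g : k := val g 1 0.
Definition md g : k := val g 1 1.

Definition torus : set (SL2 k) :=
  [set g | exists2 t, t != 0 & [/\ ma g = t^-1, mb g = 0, mc g = 0 & md g = t]].

Definition Bbar : set (SL2 k) := [set g | mb g = 0].

Definition Ubar : set (SL2 k) := [set g | [/\ ma g = 1, mb g = 0 & md g = 1]].

Definition mu (f : nat) : set (SL2 k) := [set g | torus g /\ (g ^+ f = 1)%g].

Definition mu_Ubar (f : nat) : set (SL2 k) :=
  [set g | exists t u, [/\ mu f t, Ubar u & g = (t * u)%g]].

End SL2Group.

Definition SL2fun (k : fieldType) := SL2 k -> k.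

HB.instance Definition _ (k : fieldType) := GRing.ComNzRing.on (SL2fun k).
HB.instance Definition _ (k : fieldType) :=
  GRing.Lmodule.copy (SL2fun k) (SL2 k -> k^o).

Section SL2Algebra.
Variable k : fieldType.

Fact SL2fun_scaleAl (a : k) (u v : SL2fun k) : a *: (u * v) = a *: u * v.
Proof. by apply/funext => x; apply: mulrA. Qed.
HB.instance Definition _ :=
  GRing.Lmodule_isLalgebra.Build k (SL2fun k) SL2fun_scaleAl.
HB.instance Definition _ := GRing.Lalgebra_isComAlgebra.Build k (SL2fun k).

Definition generated (n : nat) (v : 'I_n -> SL2fun k) : set (SL2fun k) :=
  [set h | exists P : {mpoly k[n]}, forall x, h x = P.@[fun i => v i x]].

(* k[SL_2] = k[a, b, c, d]/(ad - bc - 1), as the algebra of polynomial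
   functions on SL_2. *)
Definition kSL2 : set (SL2fun k) :=
  generated (tnth [tuple (@ma k : SL2fun k); @mb k; @mc k; @md k]).

Definition Rinf (f : nat) : set (SL2fun k) :=
  generated (fun i : 'I_f.+1 => fun x => md x ^+ i * mb x ^+ (f - i)).

Definition right_invariants (H : set (SL2 k)) : set (SL2fun k) :=
  [set h | kSL2 h /\ forall s x, H s -> h (x * s)%g = h x].

Variable H : set (SL2 k).

Definition right_invariant_pred : {pred SL2fun k} :=
  fun h => `[< right_invariants H h >].

Fact right_invariant_subalg : subalg_closed right_invariant_pred.
Proof.
split.
- apply/asboolP; split=> //; exists 1 => x.
  by rewrite mevalC.
- move=> a u v /asboolP[[P hP] iu] /asboolP[[Q hQ] iv]; apply/asboolP; split.
    by exists (a *: P + Q) => x; rewrite mevalD mevalZ -hP -hQ.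
  by move=> s x Hs; rewrite -[LHS]/(a * u _ + v _) iu // iv.
- move=> u v /asboolP[[P hP] iu] /asboolP[[Q hQ] iv]; apply/asboolP; split.
    by exists (P * Q) => x; rewrite mevalM -hP -hQ.
  by move=> s x Hs; rewrite -[LHS]/(u _ * v _) iu // iv.
Qed.

HB.instance Definition _ :=
  GRing.isSubalgClosed.Build k (SL2fun k) right_invariant_pred
    right_invariant_subalg.

Definition right_invariant_ring := {h | h \in right_invariant_pred}.

HB.instance Definition _ := SubChoice.on right_invariant_ring.
HB.instance Definition _ :=
  [SubChoice_isSubAlgebra of right_invariant_ring by <:].
HB.instance Definition _ :=
  [SubNzRing_isSubComNzRing of right_invariant_ring by <:].

Definition left_translate (g : SL2 k) (h : SL2fun k) : SL2fun k :=
  fun x => h (g^-1 * x)%g.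

Lemma mxS (g x : SL2 k) i j :
  val (g * x)%g i j = val g i 0 * val x 0 j + val g i 1 * val x 1 j.
Proof.
rewrite /= mxE big_ord_recl big_ord1.
by rewrite (_ : lift ord0 ord0 = 1) //; apply: val_inj.
Qed.

Fact left_translate_kSL2 g h : kSL2 h -> kSL2 (left_translate g h).
Proof.
move=> [P hP]; set m := val (g^-1)%g.
pose v : 4.-tuple {mpoly k[4]} :=
  [tuple m 0 0 *: 'X_(inord 0) + m 0 1 *: 'X_(inord 2);
         m 0 0 *: 'X_(inord 1) + m 0 1 *: 'X_(inord 3);
         m 1 0 *: 'X_(inord 0) + m 1 1 *: 'X_(inord 2);
         m 1 0 *: 'X_(inord 1) + m 1 1 *: 'X_(inord 3)].
exists (P \mPo v) => x; rewrite /left_translate hP comp_mpoly_meval.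
apply: meval_eq => i; rewrite !(tnth_nth 0).
by case: i => [[|[|[|[|//]]]]] ?; rewrite /= mevalD !mevalZ !mevalXU
  !(tnth_nth 0) !inordK // /ma /mb /mc /md mxS.
Qed.

Fact left_translate_subproof g (h : right_invariant_ring) :
  left_translate g (val h) \in right_invariant_pred.
Proof.
have /asboolP[hk hi] := valP h; apply/asboolP; split.
  exact: left_translate_kSL2.
by move=> s x Hs; rewrite /left_translate mulgA hi.
Qed.

Definition ltranslate g (h : right_invariant_ring) : right_invariant_ring :=
  Sub (left_translate g (val h)) (left_translate_subproof g h).

Fact ltranslate_linear g : linear (ltranslate g).
Proof. by move=> a u v; apply: val_inj; apply/funext => x. Qed.

Fact ltranslate_monoid g : monoid_morphism (ltranslate g).
Proof.
by split=> [|u v]; apply: val_inj; apply/funext => x.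
Qed.

HB.instance Definition _ g :=
  GRing.isLinear.Build k right_invariant_ring right_invariant_ring _
    (ltranslate g) (ltranslate_linear g).
HB.instance Definition _ g :=
  GRing.isMonoidMorphism.Build right_invariant_ring right_invariant_ring
    (ltranslate g) (ltranslate_monoid g).

(* SL_2 // H, with the action dual to the left regular representation. *)
Definition SL2_quotient : kspace k := Spec right_invariant_ring.

Definition SL2_quotient_act (g : SL2 k) (xi : SL2_quotient) : SL2_quotient :=
  (xi : {lrmorphism right_invariant_ring -> k^o}) \o ltranslate g^-1%g.

End SL2Algebra.

Record SL2_action (k : fieldType) (X : affineVariety k) := SL2Action {
  act :> SL2 k -> X -> X;
  act1 : forall x, act 1%g x = x;
  actM : forall g h x, act (g * h)%g x = act g (act h x);
  (* SL_2 x X -> X is a morphism: h o act lies in k[SL_2] (x) k[X]. *)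
  act_regular : forall h : avcoord X,
    exists (n : nat) (F : 'I_n -> SL2fun k) (G : 'I_n -> avcoord X),
      (forall i, kSL2 (F i)) /\
      forall g x, aveval (act g x) h = \sum_(i < n) F i g * aveval x (G i)
}.

Section SL2Variety.
Variables (k : fieldType) (X : affineVariety k) (a : SL2_action X).

Definition orbit (H : set (SL2 k)) (x : X) : set X := [set a g x | g in H].

Definition has_open_dense_orbit : Prop :=
  exists x, zariski_open (orbit setT x) /\ zariski_dense (orbit setT x).

Definition homogeneous : Prop := exists x, orbit setT x = setT.

Definition spherical : Prop :=
  normal_variety X /\ exists x, zariski_dense (orbit (@Bbar k) x).

Variable H : set (SL2 k).

Definition invariant_pred : {pred avcoord X} :=
  fun h => `[< forall g x, H g -> aveval (a g^-1%g x) h = aveval x h >].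

Fact invariant_subring : subring_closed invariant_pred.
Proof.
split.
- by apply/asboolP=> g x _; rewrite !rmorph1.
- move=> u v /asboolP iu /asboolP iv; apply/asboolP=> g x Hg.
  by rewrite !rmorphB; congr (_ - _); [apply: iu | apply: iv].
- move=> u v /asboolP iu /asboolP iv; apply/asboolP=> g x Hg.
  by rewrite !rmorphM; congr (_ * _); [apply: iu | apply: iv].
Qed.

HB.instance Definition _ :=
  GRing.isSubringClosed.Build (avcoord X) invariant_pred invariant_subring.

Definition invariant_ring := {h | h \in invariant_pred}.

HB.instance Definition _ := SubChoice.on invariant_ring.
HB.instance Definition _ := [SubChoice_isSubComNzRing of invariant_ring by <:].

End SL2Variety.

Definition equivariantly_isomorphic (k : fieldType) (X Y : kspace k)
    (aX : SL2 k -> X -> X) (aY : SL2 k -> Y -> Y) : Prop :=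
  exists (phi : X -> Y) (psi : Y -> X),
    [/\ cancel phi psi, cancel psi phi, is_morphism phi, is_morphism psi &
        forall g x, phi (aX g x) = aY g (phi x)].

(* Main.v *)
Require Import Defs.
From HB Require Import structures.
From mathcomp Require Import all_boot all_order all_algebra.
From mathcomp Require Import mathcomp_extra boolp classical_sets functions.
From mathcomp Require Import mpoly.
From mathcomp Require Import separable cyclotomic ring zify.

(* A point x0 of the open orbit embeds k[X] into k[SL_2] by h |-> h(g x0), and
   a Ubar-invariant of weight n becomes a binary form of degree n in the first
   row (a, b) of g. As k[X]^Ubar has dimension 1, any two such forms have
   proportional powers. Since X is not homogeneous, some nonconstant form P
   vanishes on the complement of the orbit; all its transvectants with itself
   are again in k[X]^Ubar and vanish there too. If P had a root of multiplicity
   e with 0 < e <= n/2, the transvectant of order 2e would not vanish at this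
   root: it would not be proportional to a power of P, or it would be a nonzero
   constant that vanishes somewhere. So P has a single root, and P = b^n after
   moving x0. All invariants are then polynomials in b, whose exponents are the
   multiples of some f by normality, whence the stabilizer of x0 contains mu_f
   Ubar and k[X] is identified with k[SL_2]^(mu_f Ubar). *)

Set Implicit Arguments.
Unset Strict Implicit.
Unset Printing Implicit Defensive.

Import GRing.Theory.

Local Open Scope classical_set_scope.
Local Open Scope ring_scope.

(** * Matrices *)

Section SL2Matrices.
Variable k : fieldType.
Implicit Types (g h : SL2 k) (a b c d s t z : k).

(* Only meaningful when a * d - b * c = 1; otherwise sl2 a b c d is 1. *)
Definition sl2 a b c d : SL2 k :=
  insubd (SL2_one k) (\matrix_(i, j) if i == 0 then (if j == 0 then a else b)
                                     else (if j == 0 then c else d)).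

Lemma det_SL2 g : ma g * md g - mb g * mc g = 1.
Proof.
have := SL2_det g; rewrite (expand_det_row _ 0) big_ord_recl big_ord1.
rewrite /cofactor !det_mx11 !mxE /= /bump /= expr1 addn0 expr0 mul1r.
rewrite mulN1r mulrN /ma /mb /mc /md.
have l1 : lift ord0 (ord0 : 'I_1) = (1 : 'I_2) by apply: val_inj.
have l2 : lift (1 : 'I_2) (ord0 : 'I_1) = (0 : 'I_2) by apply: val_inj.
have l3 : lift (0 : 'I_2) (0 : 'I_1) = (1 : 'I_2) by apply: val_inj.
have l4 : lift (1 : 'I_2) (0 : 'I_1) = (0 : 'I_2) by apply: val_inj.
by rewrite ?l1 ?l2 ?l3 ?l4.
Qed.

Lemma SL2P g h : ma g = ma h -> mb g = mb h -> mc g = mc h -> md g = md h ->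
  g = h.
Proof.
move=> ea eb ec ed; apply: val_inj; apply/matrixP => i j.
have I2 (P : 'I_2 -> Prop) : P 0 -> P 1 -> forall l, P l.
  by move=> P0 P1 [[|[|//]] l2]; [move: P0 | move: P1];
    congr (P _); apply: val_inj.
by move: j; apply: (I2); move: i; apply: (I2).
Qed.

Lemma sl2E a b c d : a * d - b * c = 1 ->
  [/\ ma (sl2 a b c d) = a, mb (sl2 a b c d) = b,
      mc (sl2 a b c d) = c & md (sl2 a b c d) = d].
Proof.
move=> D; rewrite /ma /mb /mc /md /sl2 val_insubd.
set M := (\matrix_(i, j) _); have -> : \det M == 1; last by rewrite !mxE.
rewrite (expand_det_row _ 0) big_ord_recl big_ord1.
rewrite /cofactor !det_mx11 !mxE /= /bump /= expr1 addn0 expr0 mul1r.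
by rewrite mulN1r mulrN D.
Qed.

Lemma maM g h : ma (g * h)%g = ma g * ma h + mb g * mc h.
Proof. exact: mxS. Qed.
Lemma mbM g h : mb (g * h)%g = ma g * mb h + mb g * md h.
Proof. exact: mxS. Qed.
Lemma mcM g h : mc (g * h)%g = mc g * ma h + md g * mc h.
Proof. exact: mxS. Qed.
Lemma mdM g h : md (g * h)%g = mc g * mb h + md g * md h.
Proof. exact: mxS. Qed.

Lemma ma1 : ma (1%g : SL2 k) = 1. Proof. by rewrite /ma /= mxE. Qed.
Lemma mb1 : mb (1%g : SL2 k) = 0. Proof. by rewrite /mb /= mxE. Qed.
Lemma mc1 : mc (1%g : SL2 k) = 0. Proof. by rewrite /mc /= mxE. Qed.
Lemma md1 : md (1%g : SL2 k) = 1. Proof. by rewrite /md /= mxE. Qed.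

Definition lo s := sl2 1 0 s 1.
Definition up s := sl2 1 s 0 1.
(* tor 0 = 1, because then the determinant is 0. *)
Definition tor t := sl2 t^-1 0 0 t.
(* The lower triangular subgroup moves wlo 0 to all wlo s; the first row of wlo
   s is (s, 1). *)
Definition wlo s := sl2 s 1 (-1) 0.

Lemma loE s : ((ma (lo s) = 1) * (mb (lo s) = 0)) *
               ((mc (lo s) = s) * (md (lo s) = 1)).
Proof. by case: (@sl2E 1 0 s 1) => //; ring. Qed.
Lemma upE s : ((ma (up s) = 1) * (mb (up s) = s)) *
               ((mc (up s) = 0) * (md (up s) = 1)).
Proof. by case: (@sl2E 1 s 0 1) => //; ring. Qed.
Lemma torE t : t != 0 -> ((ma (tor t) = t^-1) * (mb (tor t) = 0)) *
               ((mc (tor t) = 0) * (md (tor t) = t)).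
Proof. by move=> t0; case: (@sl2E t^-1 0 0 t) => //; field. Qed.
Lemma wloE s : ((ma (wlo s) = s) * (mb (wlo s) = 1)) *
               ((mc (wlo s) = -1) * (md (wlo s) = 0)).
Proof. by case: (@sl2E s 1 (-1) 0) => //; ring. Qed.

Definition entriesM := (maM, mbM, mcM, mdM).

Lemma lo0 : lo 0 = 1%g.
Proof. by apply: SL2P; rewrite !loE ?ma1 ?mb1 ?mc1 ?md1. Qed.

Lemma up0 : up 0 = 1%g.
Proof. by apply: SL2P; rewrite !upE ?ma1 ?mb1 ?mc1 ?md1. Qed.

Lemma tor1 : tor 1 = 1%g.
Proof.
by apply: SL2P; rewrite !torE ?oner_neq0 ?invr1 ?ma1 ?mb1 ?mc1 ?md1.
Qed.

Lemma loD s t : (lo s * lo t)%g = lo (s + t).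
Proof. by apply: SL2P; rewrite entriesM !loE; ring. Qed.

Lemma upD s t : (up s * up t)%g = up (s + t).
Proof. by apply: SL2P; rewrite entriesM !upE; ring. Qed.

Lemma wloD s t : (wlo s * lo t)%g = wlo (s + t).
Proof. by apply: SL2P; rewrite entriesM !wloE !loE; ring. Qed.

Lemma torM s t : s != 0 -> t != 0 -> (tor s * tor t)%g = tor (s * t).
Proof.
move=> s0 t0; have st0 : s * t != 0 by rewrite mulf_neq0.
by apply: SL2P; rewrite entriesM !torE //; field; rewrite ?s0 ?t0.
Qed.

Lemma tor_lo s t : t != 0 ->
  (tor t * lo s)%g = (lo (t ^+ 2 * s) * tor t)%g.
Proof.
by move=> t0; apply: SL2P; rewrite !entriesM !torE // !loE; field.
Qed.

(** The first rows (s, 1) and (1, 1/s) are proportional, so the two matrices differ by a lower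
    triangular left factor. This identity and the next compare the restrictions of a function to the
    curves [wlo] and [up]. *)
Lemma wlo_up s : s != 0 -> wlo s = (lo (- s^-1) * tor s^-1 * up s^-1)%g.
Proof.
move=> s0; have ? : s^-1 != 0 by rewrite invr_eq0.
by apply: SL2P; rewrite !entriesM !torE // !wloE !loE !upE; field;
  rewrite s0 oner_neq0.
Qed.

Lemma up_wlo s : s != 0 -> up s = (lo s^-1 * tor s^-1 * wlo s^-1)%g.
Proof.
move=> s0; have ? : s^-1 != 0 by rewrite invr_eq0.
by apply: SL2P; rewrite !entriesM !torE // !wloE !loE !upE; field;
  rewrite s0 oner_neq0.
Qed.

Lemma mcE g : mb g != 0 -> mc g = (ma g * md g - 1) / mb g.
Proof.
by move=> b0; apply: (mulIf b0); rewrite divfK // -(det_SL2 g); ring.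
Qed.

(** The locus b != 0 is the big cell; on it, a function semi-invariant under lower triangular left
    factors is determined by its values on [wlo]. *)
Lemma bruhat g : mb g != 0 ->
  g = (lo (md g / mb g) * tor (mb g)^-1 * wlo (ma g / mb g))%g.
Proof.
move=> b0; have ? : (mb g)^-1 != 0 by rewrite invr_eq0.
apply: SL2P; rewrite !entriesM !torE // !wloE !loE;
  try by field; rewrite b0 ?oner_neq0.
by rewrite mcE //; field; rewrite b0 ?oner_neq0.
Qed.

Lemma torX z n : z != 0 -> (tor z ^+ n)%g = tor (z ^+ n).
Proof.
move=> z0; elim: n => [|n IHn]; first by rewrite expr0 tor1.
by rewrite expgS IHn torM ?expf_neq0 // exprS.
Qed.

End SL2Matrices.

(** * Regular functions along curves *)

Section ClosedFieldPolynomials.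
Variable k : closedFieldType.

Lemma poly_eq0_punctured (q : {poly k}) :
  (forall t, t != 0 -> q.[t] = 0) -> q = 0.
Proof.
move=> q0; apply/eqP; apply: contraT => qN0.
(* A root t of q X + 1 satisfies q(t) t = -1, so t and q(t) are nonzero. *)
have /closed_rootP[t] : size (q * 'X + 1) != 1.
  by rewrite size_MXaddC (negPf qN0) /= eqSS size_poly_eq0.
rewrite rootE !hornerE; have [->|t0] := eqVneq t 0.
  by rewrite mulr0 add0r oner_eq0.
by rewrite q0 // mul0r add0r oner_eq0.
Qed.

Lemma poly_eq_punctured (p q : {poly k}) :
  (forall t, t != 0 -> p.[t] = q.[t]) -> p = q.
Proof.
move=> pq; apply/eqP; rewrite -subr_eq0; apply/eqP.
by apply: poly_eq0_punctured => t t0; rewrite hornerD hornerN pq // subrr.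
Qed.

Lemma unity_neq0 f (z : k) : (0 < f)%N -> z ^+ f = 1 -> z != 0.
Proof.
move=> f0; apply: contra_eq_neq => ->.
by rewrite expr0n eqn0Ngt f0 eq_sym oner_neq0.
Qed.

(** The Laurent polynomial a^(M - i) p(1/a) is the polynomial q(a), so the exponent M - i - j of its
    term p_j is nonnegative. *)
Lemma laurent_reversal_bound (p q : {poly k}) i M :
    (forall a, a != 0 -> a ^+ i * q.[a] = a ^+ M * p.[a^-1]) ->
  forall j, p`_j != 0 -> (i + j <= M)%N.
Proof.
move=> pq j pj; rewrite leqNgt; apply/negP => ltM.
have ltj : (j < size p)%N by rewrite ltnNge; apply: contra pj => /leq_sizeP->.
pose d := size p.
have eqp : 'X^(i + d) * q = 'X^M * \poly_(l < d.+1) p`_(d - l).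
  apply: poly_eq_punctured => a a0; rewrite !hornerE.
  rewrite exprD -mulrA mulrCA pq // mulrCA; congr (_ * _).
  rewrite horner_poly (reindex_inj rev_ord_inj) /= big_ord_recr /=.
  rewrite subSS subnn subn0 nth_default // mul0r addr0.
  rewrite horner_coef mulr_sumr; apply: eq_bigr => l _.
  rewrite subSS subKn 1?ltnW // mulrCA exprVn; congr (_ * _).
  by rewrite -exprB ?unitfE 1?ltnW.
(* If M < i + j, then M + d - j < i + d, so this coefficient is 0 on the left, while on the right it
   is p_j. *)
have := congr1 (fun r : {poly k} => r`_(M + (d - j))) eqp.
rewrite !coefXnM coef_poly; case: ifP => [_|/negbT]; last first.
  by rewrite -/d in ltj; lia.
rewrite ltnNge leq_addr /= addKn ltnS leq_subr subKn 1?ltnW // => /esym/eqP.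
by rewrite (negPf pj).
Qed.

(** Here R is a ring of functions on the parameter space T, [eps] evaluates them, and w clears the
    denominators of the matrix entries; induction on the monomials of F accumulates the power of w.
    It serves for curves and for families with two parameters. *)
Lemma kSL2_param (T : Type) (D : T -> Prop) (R : comNzRingType) (iota : k -> R)
    (eps : T -> {rmorphism R -> k}) (w : R) (gamma : T -> SL2 k)
    (qa qb qc qd : R) (F : SL2fun k) :
  (forall tau c, eps tau (iota c) = c) ->
  (forall tau, D tau -> [/\ eps tau w * ma (gamma tau) = eps tau qa,
     eps tau w * mb (gamma tau) = eps tau qb,
     eps tau w * mc (gamma tau) = eps tau qc &
     eps tau w * md (gamma tau) = eps tau qd]) ->
  kSL2 F ->
  exists M Q, forall tau, D tau -> eps tau w ^+ M * F (gamma tau) = eps tau Q.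
Proof.
move=> epsK wE [P FP].
pose q := tnth [tuple qa; qb; qc; qd].
pose v x := tnth [tuple (@ma k : SL2fun k); @mb k; @mc k; @md k] ^~ x.
have {}wE tau i : D tau ->
    eps tau w * tnth [tuple (@ma k : SL2fun k); @mb k; @mc k; @md k] i
      (gamma tau) = eps tau (q i).
  move=> /wE[]; rewrite /q !(tnth_nth 0).
  by case: i => [[|[|[|[|//]]]] ?].
suff [M [Q PQ]] : exists M Q, forall tau, D tau -> eps tau w ^+ M *
    P.@[fun i => tnth [tuple (@ma k : SL2fun k); @mb k; @mc k; @md k] i
                   (gamma tau)] = eps tau Q.
  by exists M, Q => tau /PQ; rewrite FP.
elim/mpolyind: P {F FP} => [|c m P _ _ [M [Q PQ]]].
  by exists 0, 0 => tau _; rewrite meval0 mulr0 rmorph0.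
exists (mdeg m + M)%N, (iota c * w ^+ M * \prod_i q i ^+ m i + w ^+ mdeg m * Q).
move=> tau Dtau; rewrite mevalD mevalZ mevalX.
rewrite !(rmorphD, rmorphM, rmorphXn, rmorph_prod) epsK -PQ // exprD mulrDr.
set W := eps tau w; set y := meval _ P.
have -> : \prod_i eps tau (q i ^+ m i) = W ^+ mdeg m *
    \prod_i tnth [tuple (@ma k : SL2fun k); @mb k; @mc k; @md k] i
      (gamma tau) ^+ m i.
  under eq_bigr do rewrite rmorphXn -wE // exprMn.
  by rewrite big_split /= mdegE -prodrXr.
by ring.
Qed.

End ClosedFieldPolynomials.

(** * Subalgebras of functions on SL_2 *)

Section Generated.
Variables (k : fieldType) (n : nat) (v : 'I_n -> SL2fun k).

Lemma generated_cst c : generated v (fun=> c).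
Proof. by exists c%:MP => x; rewrite mevalC. Qed.

Lemma generated_gen i : generated v (v i).
Proof. by exists 'X_i => x; rewrite mevalXU. Qed.

Lemma generatedD (F G : SL2fun k) :
  generated v F -> generated v G -> generated v (fun x => F x + G x).
Proof. by move=> [P FP] [Q GQ]; exists (P + Q) => x; rewrite mevalD FP GQ. Qed.

Lemma generatedM (F G : SL2fun k) :
  generated v F -> generated v G -> generated v (fun x => F x * G x).
Proof. by move=> [P FP] [Q GQ]; exists (P * Q) => x; rewrite mevalM FP GQ. Qed.

Lemma generatedX (F : SL2fun k) i :
  generated v F -> generated v (fun x => F x ^+ i).
Proof. by move=> [P FP]; exists (P ^+ i) => x; rewrite rmorphXn /= FP. Qed.

Lemma generated_sum (I : Type) (r : seq I) (F : I -> SL2fun k) :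
  (forall i, generated v (F i)) -> generated v (fun x => \sum_(i <- r) F i x).
Proof.
move=> vF; elim: r => [|i r IHr].
  under eq_fun do rewrite big_nil.
  exact: generated_cst.
under eq_fun do rewrite big_cons.
exact: generatedD.
Qed.

End Generated.

Section KSL2.
Variable k : closedFieldType.

Lemma kSL2_ma : kSL2 (@ma k). Proof. exact: (generated_gen _ 0). Qed.
Lemma kSL2_mb : kSL2 (@mb k). Proof. exact: (generated_gen _ 1). Qed.
Lemma kSL2_md : kSL2 (@md k). Proof. exact: (generated_gen _ 3). Qed.

Lemma kSL2_curve (F : SL2fun k) (gamma : k -> SL2 k) (qa qb qc qd : {poly k}) :
    (forall t, [/\ ma (gamma t) = qa.[t], mb (gamma t) = qb.[t],
                   mc (gamma t) = qc.[t] & md (gamma t) = qd.[t]]) ->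
  kSL2 F -> exists Q : {poly k}, forall t, F (gamma t) = Q.[t].
Proof.
move=> gE kF.
have [||M [Q FQ]] := @kSL2_param k k xpredT {poly k} polyC
  (fun t => horner_eval t) 1 gamma qa qb qc qd F _ _ kF.
- by move=> t c; exact: hornerC.
- by move=> t _; rewrite rmorph1 !mul1r.
by exists Q => t; have := FQ t isT; rewrite rmorph1 expr1n mul1r.
Qed.

(** Density of the big cell: if b = 0 then d != 0, and the curve [up t * g], whose upper right entry
    is d t, lies in the cell for t != 0 and passes through g at t = 0. *)
Lemma kSL2_eq_mb (F G : SL2fun k) : kSL2 F -> kSL2 G ->
  (forall g, mb g != 0 -> F g = G g) -> F =1 G.
Proof.
move=> kF kG FG g; have [b0|/FG//] := eqVneq (mb g) 0.
have d0 : md g != 0.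
  apply: contraTneq (oner_neq0 k) => d0.
  by rewrite -(det_SL2 g) b0 d0 mulr0 mul0r subrr eqxx.
have gE t : [/\ ma (up t * g)%g = ((ma g)%:P + mc g *: 'X).[t],
    mb (up t * g)%g = ((mb g)%:P + md g *: 'X).[t],
    mc (up t * g)%g = (mc g)%:P.[t] & md (up t * g)%g = (md g)%:P.[t]].
  by rewrite !entriesM !upE !hornerE; split; ring.
have [P FP] := kSL2_curve gE kF; have [Q GQ] := kSL2_curve gE kG.
have g1 : (up 0 * g)%g = g by apply: SL2P; rewrite entriesM !upE; ring.
rewrite -g1 FP GQ; congr _.[_]; apply: poly_eq_punctured => t t0.
rewrite -FP -GQ; apply: FG; have [_ -> _ _] := gE t.
by rewrite b0 !hornerE mulf_neq0.
Qed.

End KSL2.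

(** * Evaluation at points and the action along curves *)

Section Evaluation.
Variables (k : fieldType) (X : affineVariety k).

(** Retyped with values in the field k instead of the regular module [k^o], so that it is a ring
    morphism into k. *)
Definition ev (x : X) (h : avcoord X) : k := aveval x h.

Fact ev_zmod x : zmod_morphism (ev x).
Proof. by move=> u v; apply: rmorphB. Qed.
Fact ev_monoid x : monoid_morphism (ev x).
Proof. by split=> [|u v]; [apply: rmorph1 | apply: rmorphM]. Qed.
HB.instance Definition _ x :=
  GRing.isZmodMorphism.Build (avcoord X) k (ev x) (ev_zmod x).
HB.instance Definition _ x :=
  GRing.isMonoidMorphism.Build (avcoord X) k (ev x) (ev_monoid x).

Lemma evZ x c h : ev x (c *: h) = c * ev x h.
Proof. by rewrite /ev linearZ. Qed.

Lemma ev_alg x c : ev x c%:A = c.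
Proof. by rewrite evZ rmorph1 mulr1. Qed.

Lemma ev_inj h h' : (forall x, ev x h = ev x h') -> h = h'.
Proof. exact: av_faithful. Qed.

Lemma ev_point_inj x y : (forall h, ev x h = ev y h) -> x = y.
Proof.
move=> exy; have [z [_ zU]] := av_points (aveval x).
by rewrite -(zU x) // (zU y) // => h; apply/esym/exy.
Qed.

End Evaluation.

Section Action.
Variables (k : closedFieldType) (X : affineVariety k) (a : SL2_action X).
Implicit Types (h : avcoord X) (x : X) (g : SL2 k).

Lemma translate_ex g h : exists h', forall x, ev x h' = ev (a g x) h.
Proof.
have [n [F [G [_ hE]]]] := act_regular a h.
exists (\sum_(i < n) F i g *: G i) => x.
by rewrite rmorph_sum [RHS]hE; apply: eq_bigr => i _; apply: evZ.
Qed.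

Lemma orbit_map_kSL2 x h : kSL2 (fun g => ev (a g x) h).
Proof.
have [n [F [G [kF hE]]]] := act_regular a h.
rewrite /ev; under eq_fun do rewrite hE.
apply: generated_sum => i; apply: generatedM; first exact: kF.
exact: generated_cst.
Qed.

(** By regularity of the action, finitely many functions on SL_2 have to be followed along the
    curve; the sum of their exponents is a common power of w clearing all denominators. *)
Lemma act_param (D : k -> Prop) (w qa qb qc qd : {poly k})
    (gamma : k -> SL2 k) h :
    (forall t, D t -> [/\ w.[t] * ma (gamma t) = qa.[t],
       w.[t] * mb (gamma t) = qb.[t], w.[t] * mc (gamma t) = qc.[t] &
       w.[t] * md (gamma t) = qd.[t]]) ->
  exists M (H : {poly avcoord X}), forall t x, D t ->
    w.[t] ^+ M * ev (a (gamma t) x) h = (map_poly (ev x) H).[t].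
Proof.
move=> gE; have [n [F [G [kF hE]]]] := act_regular a h.
have FE i : exists MQ : nat * {poly k}, forall t, D t ->
    w.[t] ^+ MQ.1 * F i (gamma t) = MQ.2.[t].
  have [||M [Q FQ]] := @kSL2_param k k D {poly k} polyC
    (fun t => horner_eval t) w gamma qa qb qc qd (F i) _ _ (kF i).
  - by move=> t c; apply: hornerC.
  - exact: gE.
  by exists (M, Q).
have {FE}[MQ FE] := choice FE; pose M := (\sum_i (MQ i).1)%N.
exists M, (\sum_i map_poly (in_alg (avcoord X)) ((MQ i).2 * w ^+ (M - (MQ i).1))
           * (G i)%:P) => t x Dt.
rewrite /ev hE mulr_sumr rmorph_sum horner_sum; apply: eq_bigr => i _.
rewrite rmorphM /= map_polyC hornerM hornerC -map_poly_comp.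
rewrite (eq_map_poly (g := idfun)); last by move=> c; apply: ev_alg.
rewrite map_poly_id // hornerM horner_exp -FE // mulrA; congr (_ * _).
rewrite mulrAC -exprD subnKC // /M (bigD1 i) //=; exact: leq_addr.
Qed.

Lemma act_curve (gamma : k -> SL2 k) (qa qb qc qd : {poly k}) h :
    (forall t, [/\ ma (gamma t) = qa.[t], mb (gamma t) = qb.[t],
                   mc (gamma t) = qc.[t] & md (gamma t) = qd.[t]]) ->
  exists H : {poly avcoord X}, forall t x,
    ev (a (gamma t) x) h = (map_poly (ev x) H).[t].
Proof.
move=> gE; have [|M [H hH]] := @act_param xpredT 1 qa qb qc qd gamma h.
  by move=> t _; rewrite !hornerE ?mul1r; apply: gE.
by exists H => t x; rewrite -hH // !hornerE ?expr1n ?mul1r.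
Qed.

Lemma act_lo h : exists H : {poly avcoord X}, forall t x,
  ev (a (lo t) x) h = (map_poly (ev x) H).[t].
Proof.
apply: (@act_curve _ 1 0 'X 1) => t.
by rewrite !loE !hornerE.
Qed.

Lemma act_up h : exists H : {poly avcoord X}, forall t x,
  ev (a (up t) x) h = (map_poly (ev x) H).[t].
Proof.
apply: (@act_curve _ 1 'X 0 1) => t.
by rewrite !upE !hornerE.
Qed.

Lemma act_wlo h : exists H : {poly avcoord X}, forall t x,
  ev (a (wlo t) x) h = (map_poly (ev x) H).[t].
Proof.
apply: (@act_curve _ 'X 1 (-1) 0) => t.
by rewrite !wloE !hornerE.
Qed.

Lemma act_tor h : exists M (H : {poly avcoord X}), forall t x, t != 0 ->
  t ^+ M * ev (a (tor t) x) h = (map_poly (ev x) H).[t].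
Proof.
have [|M [H hH]] := @act_param (fun t => t != 0) 'X 1 0 0 ('X * 'X) (@tor k) h.
  by move=> t t0; rewrite !torE // !hornerE mulfV ?mulr0.
by exists M, H => t x t0; rewrite -hH // hornerX.
Qed.

Lemma actK g x : a g^-1%g (a g x) = x.
Proof. by rewrite -actM mulVg act1. Qed.

End Action.

(** * Unipotent invariants and their weights *)

Section Weights.
Variables (k : closedFieldType) (X : affineVariety k) (a : SL2_action X).
Implicit Types (h : avcoord X) (x : X) (g : SL2 k).

Definition U_inv h := forall s x, ev (a (lo s) x) h = ev x h.

(** The sign convention makes n the degree of h as a binary form in (a, b), so that all weights are
    natural numbers. *)
Definition wt n h := U_inv h /\
  forall t x, t != 0 -> t ^+ n * ev (a (tor t) x) h = ev x h.

Lemma act_mul g g' x : a g (a g' x) = a (g * g')%g x.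
Proof. by rewrite actM. Qed.

(* As a function of the first row (a, b) of the group element, h is homogeneous
   of degree M - i, hence q(s) = s^(M - i) p(1/s) for its restrictions p and q
   to the curves (1, s) and (s, 1). *)
Lemma weight_ge0 h i M : U_inv h -> h != 0 ->
    (forall t x, t != 0 -> t ^+ M * ev (a (tor t) x) h = t ^+ i * ev x h) ->
  (i <= M)%N.
Proof.
move=> Uh h0 wh.
have [x hx] : exists x, ev x h != 0.
  apply: contrapT => hx; case/eqP: h0; apply: ev_inj => x.
  by rewrite rmorph0; apply: contrapT => /eqP hx0; apply: hx; exists x.
have [P hP] := act_up a h; have [Q hQ] := act_wlo a h.
rewrite -[i]addn0; apply: (@laurent_reversal_bound k (map_poly (ev x) P)
  (map_poly (ev x) Q)) => [s s0|].
  have si0 : s^-1 != 0 by rewrite invr_eq0.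
  rewrite -hP -hQ wlo_up // !actM Uh.
  have := wh s^-1 (a (up s^-1) x) si0; rewrite !exprVn.
  move: (ev _ h) (ev _ h) => z y /(congr1 (fun c => s ^+ M * s ^+ i * c)) E.
  transitivity (s ^+ M * s ^+ i * ((s ^+ M)^-1 * y)); last rewrite E.
    by field; rewrite expf_neq0.
  by field; rewrite expf_neq0.
by rewrite -horner_coef0 -hP up0 act1.
Qed.

(** On the big cell h(g x) = b^n Q(a/b) with Q(s) = h([wlo s] x). Comparison with the curve [up]
    bounds the degree of Q by n, and density of the cell extends the formula to all g. *)
Lemma wt_binary_form n h : wt n h -> exists H : nat -> avcoord X,
  forall g x, ev (a g x) h =
    \sum_(j < n.+1) ev x (H j) * ma g ^+ (n - j) * mb g ^+ j.
Proof.
move=> [Uh wh].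
have wh' t x : t != 0 -> ev (a (tor t^-1) x) h = t ^+ n * ev x h.
  move=> t0; rewrite -[in RHS](wh t^-1) ?invr_eq0 // mulrA -exprMn mulfV //.
  by rewrite expr1n mul1r.
have [P hP] := act_up a h; have [Q hQ] := act_wlo a h.
have Qn x j : (map_poly (ev x) Q)`_j != 0 -> (j <= n)%N.
  rewrite -{2}[j]add0n.
  apply: (@laurent_reversal_bound k _ (map_poly (ev x) P)) => s s0.
  by rewrite -hP -hQ up_wlo // !actM Uh wh' // mul1r.
exists (fun j => Q`_(n - j)) => g x; move: g.
apply: kSL2_eq_mb => [||g b0]; first exact: orbit_map_kSL2.
  apply: generated_sum => j; apply: generatedM; last first.
    by apply: generatedX; apply: kSL2_mb.
  apply: generatedM; first exact: generated_cst.
  by apply: generatedX; apply: kSL2_ma.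
rewrite {1}(bruhat b0) !actM Uh wh' // hQ (horner_coef_wide (n := n.+1)).
  rewrite (reindex_inj rev_ord_inj) mulr_sumr; apply: eq_bigr => /= j _.
  rewrite subSS -coef_map -mulrA mulrCA; congr (_ * _).
  rewrite -{1}(@subnK j n) -1?ltnS // exprD expr_div_n.
  by field; rewrite expf_neq0.
apply/leq_sizeP => j nj; apply/eqP; apply: contraLR nj => /Qn.
by rewrite -ltnNge ltnS.
Qed.

(** The coefficient of t^i in t^M h([tor t] x) is an invariant of weight M - i; it vanishes for i >
    M because weights are nonnegative. *)
Lemma U_inv_decomposition h : U_inv h -> exists n (K : nat -> avcoord X),
  h = \sum_(j < n) K j /\ forall j, wt j (K j).
Proof.
move=> Uh; have [M [H hH]] := act_tor a h.
have UH i : U_inv H`_i.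
  move=> s x; rewrite -!coef_map.
  congr (nth 0 (polyseq _) i); apply: poly_eq_punctured => t t0.
  rewrite -!hH //.
  by rewrite act_mul tor_lo // actM Uh.
have wH i t x : t != 0 -> t ^+ M * ev (a (tor t) x) H`_i = t ^+ i * ev x H`_i.
  move=> t0; rewrite -!coef_map -coefZ.
  set Q := map_poly (ev x) H.
  have -> : t ^+ M *: map_poly (ev (a (tor t) x)) H =
            \poly_(j < size Q) (t ^+ j * Q`_j).
    apply: poly_eq_punctured => s s0; rewrite hornerZ -hH // act_mul torM //.
    rewrite mulrCA mulrA -exprMn hH ?mulf_neq0 // horner_coef horner_poly.
    by apply: eq_bigr => j _; rewrite exprMn; ring.
  by rewrite coef_poly; case: ltnP => // sQ; rewrite nth_default // mulr0.
have HM i : (M < i)%N -> H`_i = 0.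
  move=> Mi; apply/eqP; apply: contraLR Mi => Hi.
  by rewrite -leqNgt; apply: weight_ge0 (wH i).
exists M.+1, (fun j => if (j <= M)%N then H`_(M - j) else 0); split.
  apply: ev_inj => x; have := hH 1 x (oner_neq0 _).
  rewrite expr1n mul1r tor1 act1 => ->; rewrite (horner_coef_wide (n := M.+1)).
    rewrite (reindex_inj rev_ord_inj) rmorph_sum; apply: eq_bigr => /= j _.
    by rewrite subSS -ltnS ltn_ord expr1n mulr1 coef_map.
  by apply/leq_sizeP => j /HM Hj; rewrite coef_map Hj; apply: rmorph0.
move=> j; case: ifP => [jM|_]; last first.
  by split=> [s x|t x _]; rewrite !rmorph0 ?mulr0.
split=> // t x t0; apply: (mulfI (expf_neq0 (M - j) t0)).
by rewrite mulrA -exprD subnK // wH.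
Qed.

End Weights.

(** * Invariants when the Krull dimension is one *)

Lemma kernel_prime_ideal (R : comNzRingType) (D : idomainType)
    (rho : R -> D) :
    rho 0 = 0 -> rho 1 = 1 -> (forall u v, rho (u + v) = rho u + rho v) ->
    (forall u v, rho (u * v) = rho u * rho v) ->
  prime_ideal [pred u | rho u == 0].
Proof.
move=> r0 r1 rD rM; split; first split.
- by rewrite inE r0.
- by rewrite inE r1 oner_eq0.
- by move=> c u v; rewrite !inE rD rM => /eqP-> /eqP->; rewrite mulr0 addr0.
- by move=> u v; rewrite !inE rM mulf_eq0.
Qed.

Section KrullDimensionOne.
Variables (k : closedFieldType) (X : affineVariety k) (a : SL2_action X).
Implicit Types (h : avcoord X) (x : X) (g : SL2 k).

Let R := invariant_ring a (@Ubar k).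

Lemma U_invP h : U_inv a h <-> h \in invariant_pred a (@Ubar k).
Proof.
split=> [Uh|/asboolP Uh s x].
  apply/asboolP => g x [ga gb gd].
  have -> : (g^-1)%g = lo (- mc g).
    apply: (mulgI g); rewrite mulgV.
    by apply: SL2P; rewrite entriesM ?ga ?gb ?gd !loE ?ma1 ?mb1 ?mc1 ?md1; ring.
  exact: Uh.
have := Uh (lo (- s)) x; rewrite /ev => <-; last by split; rewrite loE.
congr (aveval (a _ x) h); apply: (mulgI (lo (- s))).
by rewrite mulgV loD addNr lo0.
Qed.

(* Otherwise 0, the functions vanishing on the torus orbit of a point x with h2
   x != 0, and the functions whose weight 0 component vanishes at x form a
   chain of primes of length 2. *)
Lemma wt_krull_dim1 n1 n2 h1 h2 :
    has_krull_dim R 1 -> wt a n1 h1 -> wt a n2 h2 -> h2 != 0 -> (0 < n2)%N ->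
  exists c, h1 ^+ n2 = c *: h2 ^+ n1.
Proof.
move=> [_ dimR] w1 w2 h2N0 n2_gt0.
have [x h2x] : exists x, ev x h2 != 0.
  apply: contrapT => h2x; case/eqP: h2N0; apply: ev_inj => x.
  by rewrite rmorph0; apply: contrapT => /eqP h2x0; apply: h2x; exists x.
(* Both terms have weight n1 n2 and agree at x, so F vanishes on the torus orbit of x. If F != 0, it
   separates the first two primes of the chain, and h2 separates the last two. *)
pose F := ev x h2 ^+ n1 *: h1 ^+ n2 - ev x h1 ^+ n2 *: h2 ^+ n1.
have torV n h t : wt a n h -> t != 0 -> ev (a (tor t^-1) x) h = t ^+ n * ev x h.
  move=> [_ wh] t0; rewrite -[in RHS](wh t^-1) ?invr_eq0 // mulrA -exprMn.
  by rewrite mulfV // expr1n mul1r.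
have Ftor t : t != 0 -> ev (a (tor t^-1) x) F = 0.
  move=> t0; rewrite rmorphB /= !evZ !rmorphXn /= (torV _ _ _ w1) //.
  by rewrite (torV _ _ _ w2) // !exprMn -!exprM mulnC; ring.
have [F0|FN0] := eqVneq F 0.
  exists (ev x h1 ^+ n2 / ev x h2 ^+ n1).
  have hx : ev x h2 ^+ n1 != 0 by rewrite expf_neq0.
  have /eqP := F0; rewrite subr_eq0 => /eqP/(congr1 ( *:%R (ev x h2 ^+ n1)^-1)).
  by rewrite !scalerA mulVf // scale1r mulrC.
have UF : F \in invariant_pred a (@Ubar k).
  by apply/U_invP => s y; rewrite !rmorphB /= !evZ !rmorphXn /= w1.1 w2.1.
have Uh2 : h2 \in invariant_pred a (@Ubar k) by apply/U_invP; apply: w2.1.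
(* The coefficient of t^j in this polynomial is the value at x of the weight j component of K. *)
have LP (K : R) : exists q : {poly k}, forall t, t != 0 ->
    ev (a (tor t^-1) x) (val K) = q.[t].
  have /U_invP/U_inv_decomposition[n [Kj [-> wK]]] := valP K.
  exists (\poly_(j < n) ev x (Kj j)) => t t0.
  rewrite rmorph_sum horner_poly; apply: eq_bigr => j _.
  by rewrite mulrC; apply: torV.
have {LP}[L LE] := choice LP.
have Lq K q : (forall t, t != 0 -> ev (a (tor t^-1) x) (val K) = q.[t]) ->
    L K = q.
  by move=> Kq; apply: poly_eq_punctured => t t0; rewrite -LE // Kq.
have L0 : L 0 = 0 by apply: Lq => t _; rewrite horner0; apply: rmorph0.
have L1 : L 1 = 1 by apply: Lq => t _; rewrite hornerC; apply: rmorph1.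
have LD K K' : L (K + K') = L K + L K'.
  by apply: Lq => t t0; rewrite hornerD -!LE // -rmorphD.
have LM K K' : L (K * K') = L K * L K'.
  by apply: Lq => t t0; rewrite hornerM -!LE // -rmorphM.
pose P i : {pred R} := match i with
  | 0 => [pred K | val K == 0]
  | 1 => [pred K | L K == 0]
  | _ => [pred K | (L K).[0] == 0]
  end.
suff /dimR : prime_chain 2 P by [].
split=> [[|[|i]] _|[|[|//]] _] /=.
- by apply: kernel_prime_ideal.
- by apply: kernel_prime_ideal.
- apply: (kernel_prime_ideal (rho := fun K => (L K).[0])) => [||K K'|K K'].
  + by rewrite L0 horner0.
  + by rewrite L1 hornerC.
  + by rewrite LD hornerD.
  + by rewrite LM hornerM.
- split=> [K /eqP K0|].
    rewrite inE; apply/eqP/Lq => t _; rewrite horner0.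
    exact: etrans (congr1 _ K0) (rmorph0 _).
  exists (Sub F UF); last exact: FN0.
  rewrite inE; apply/eqP/Lq => t t0; rewrite horner0; exact: Ftor.
- split=> [K /eqP K0|]; first by rewrite inE K0 horner0.
  have Lh2 : L (Sub h2 Uh2) = ev x h2 *: 'X^n2.
    apply: Lq => t t0; rewrite !hornerE mulrC; exact: torV w2 t0.
  exists (Sub h2 Uh2); rewrite inE Lh2.
    by rewrite !hornerE expr0n eqn0Ngt n2_gt0 mulr0.
  by rewrite scaler_eq0 (negPf h2x) monic_neq0 // monicXn.
Qed.

End KrullDimensionOne.

(** * Transvectants *)

Section PolynomialLemmas.
Variable k : closedFieldType.
Implicit Types p q u : {poly k}.

Lemma derivn_comp_shift q s n :
  (q \Po ('X + s%:P))^`(n) = q^`(n) \Po ('X + s%:P).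
Proof.
elim: n => [|n IHn]; first by rewrite !derivn0.
by rewrite !derivnS IHn deriv_comp derivD derivX derivC addr0 mulr1.
Qed.

Lemma lead_coef_comp_shift q s n :
  (size q <= n.+1)%N -> (q \Po ('X + s%:P))`_n = q`_n.
Proof.
move=> qn; have size_shift i : size (('X + s%:P) ^+ i) = i.+1.
  by rewrite -[s%:P]opprK -polyCN size_exp_XsubC.
rewrite comp_polyE coef_sum; have [qn'|nq] := leqP (size q) n.
  rewrite nth_default // big1 // => i _.
  rewrite coefZ [_`_n]nth_default ?mulr0 //.
  by rewrite size_shift (leq_trans _ qn').
have qE : size q = n.+1 by apply/eqP; rewrite eqn_leq qn.
rewrite qE big_ord_recr /= big1 ?add0r => [|i _].
  rewrite coefZ; have /monicP : ('X + s%:P) ^+ n \is monic.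
    by rewrite monic_exp // -[s%:P]opprK -polyCN monicXsubC.
  by rewrite /lead_coef size_shift => ->; rewrite mulr1.
by rewrite coefZ [_`_n]nth_default ?mulr0 // size_shift.
Qed.

(** Two distinct roots have multiplicities of sum at most n, so one of them is at most n/2. *)
Lemma small_multiplicity_root p n : size p = n.+1 -> (0 < n)%N ->
  (exists rho c, p = c *: ('X - rho%:P) ^+ n) \/
  exists rho e u, [/\ p = u * ('X - rho%:P) ^+ e, ~~ root u rho, (0 < e)%N &
                      (e.*2 <= n)%N].
Proof.
move=> sp n0; have pN0 : p != 0 by rewrite -size_poly_eq0 sp.
have rootX q rho : q != 0 -> root q rho -> exists e u,
    [/\ q = u * ('X - rho%:P) ^+ e, ~~ root u rho, (0 < e)%N, u != 0 &
        (size q = size u + e)%N].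
  move=> q0 qr; have [e [u ur qE]] := multiplicity_XsubC q rho.
  rewrite q0 /= in ur; exists e, u; have u0 : u != 0.
    by apply: contraNneq ur => ->; rewrite root0.
  split=> //; last first.
    by rewrite qE size_Mmonic ?monic_exp ?monicXsubC // size_exp_XsubC addnS.
  by rewrite lt0n; apply: contraNneq ur => e0; rewrite qE e0 expr0 mulr1 in qr.
have [rho pr] : exists x, root p x.
  by apply/closed_rootP; rewrite sp eqSS -lt0n.
have [e [u [pE ur e0 u0 su]]] := rootX p rho pN0 pr.
have [u1|/closed_rootP[rho' ur']] := eqVneq (size u) 1.
  left; exists rho, u`_0; rewrite -mul_polyC -size1_polyC ?u1 // {1}pE.
  by congr (_ * _ ^+ _); move: su; rewrite sp u1; lia.
have [e' [u' [uE ur'' e'0 u'0 su']]] := rootX u rho' u0 ur'.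
have su'0 : (0 < size u')%N by rewrite size_poly_gt0.
have [en|ne] := leqP e.*2 n; right; first by exists rho, e, u.
exists rho', e', (u' * ('X - rho%:P) ^+ e); split=> //; last first.
- by move: su su' su'0 ne; rewrite sp; lia.
- rewrite rootM negb_or ur'' -(prednK e0) root_exp_XsubC.
  by apply: contraNneq ur => <-.
- by rewrite pE {1}uE -!mulrA [_ ^+ e * _]mulrC.
Qed.

(* Up to normalization, the r-th transvectant of a binary form of degree n with
   itself, in terms of its dehomogenization q. *)
Definition transvectant n r q :=
  \sum_(i < r.+1) (-1) ^+ i *: (q^`(n - i) * q^`(n - (r - i))).

(** The derivative telescopes to two boundary terms, each containing the derivative of q of order n
    + 1, which is 0. In characteristic 0 a polynomial with zero derivative is constant. *)
Lemma transvectant_const n r q : [pchar k] =i pred0 ->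
  (r <= n)%N -> (size q <= n.+1)%N -> (size (transvectant n r q) <= 1)%N.
Proof.
move=> char0 rn qn.
have q0 : q^`(n.+1) = 0.
  by apply/polyP => i; rewrite coef_derivn coef0 addSn
    nth_default ?mul0rn // (leq_trans qn) // ltnS leq_addr.
pose t i := (-1) ^+ i *: (q^`(n.+1 - i) * q^`(n - r + i)).
have T' : (transvectant n r q)^`() = 0.
  transitivity (- \sum_(0 <= i < r.+1) (t i.+1 - t i)); last first.
    rewrite telescope_sumr // /t subn0 q0 mul0r scaler0 subr0.
    by rewrite addnS subnK // q0 mulr0 scaler0 oppr0.
  rewrite big_mkord -sumrN raddf_sum; apply: eq_bigr => i _ /=.
  have ir : (i <= r)%N by rewrite -ltnS.
  rewrite /t derivZ derivM -!derivnS exprS mulN1r scaleNr opprB opprK.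
  rewrite -scalerDr; congr (_ *: (_ * _ + _ * _)); congr (q^`(_)); lia.
apply/leq_sizeP => j j1; apply/eqP.
have /eqP := congr1 (fun p : {poly k} => p`_j.-1) T'.
rewrite coef_deriv coef0 prednK // -mulr_natr mulf_eq0.
by rewrite (pcharf0P _).1 // eqn0Ngt j1 orbF.
Qed.

Lemma transvectant_shift n r q s :
  transvectant n r (q \Po ('X + s%:P)) = transvectant n r q \Po ('X + s%:P).
Proof.
rewrite /transvectant raddf_sum; apply: eq_bigr => i _ /=.
by rewrite !derivn_comp_shift comp_polyZ comp_polyM.
Qed.

End PolynomialLemmas.

(** * The form vanishing on the boundary *)

Section BoundaryIdeal.
Variables (k : closedFieldType) (X : affineVariety k) (a : SL2_action X).
Implicit Types (h : avcoord X) (x : X) (g : SL2 k).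

(* The leading coefficient in s of h (lo s x) is Ubar-invariant. *)
Lemma boundary_wt (Z : set X) h :
    (forall g x, Z x -> Z (a g x)) -> h != 0 -> (forall x, Z x -> ev x h = 0) ->
  exists n h', [/\ wt a n h', h' != 0 & forall x, Z x -> ev x h' = 0].
Proof.
move=> stZ h0 Zh; have [H hH] := act_lo a h.
have hH0 x : ev x h = ev x H`_0.
  by rewrite -coef_map -horner_coef0 -hH lo0 act1.
have HN0 : H != 0.
  by apply: contraNneq h0 => H0; apply/eqP/ev_inj => x; rewrite hH0 H0 coef0.
pose l := lead_coef H; have l0 : l != 0 by rewrite lead_coef_eq0.
have Ul : U_inv a l.
  move=> s x; rewrite /l lead_coefE -!coef_map.
  rewrite -(@lead_coef_comp_shift k (map_poly (ev x) H) s); last first.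
    by rewrite (leq_trans (size_poly _ _)) // leqSpred.
  congr (nth 0 (polyseq _) _); apply: poly_eq_punctured => t _.
  by rewrite horner_comp -hH act_mul loD !hornerE -hH.
have Zl x : Z x -> ev x l = 0.
  move=> Zx; rewrite /l lead_coefE -coef_map.
  suff -> : map_poly (ev x) H = 0 by rewrite coef0.
  by apply: poly_eq0_punctured => t _; rewrite -hH Zh //; apply: stZ.
have [n [K [lE wK]]] := U_inv_decomposition Ul.
have [j Kj] : exists j : 'I_n, K j != 0.
  apply: contrapT => K0; case/eqP: l0; rewrite lE big1 // => j _.
  by apply: contrapT => /eqP Kj; apply: K0; exists j.
exists j, (K j); split=> // x Zx.
(* This polynomial in t is l([tor t^-1] x), which vanishes since Z is stable under the torus; hence
   each weight component of l vanishes on Z. *)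
have : \poly_(i < n) ev x (K i) = 0.
  apply: poly_eq0_punctured => t t0.
  have ti0 : t^-1 != 0 by rewrite invr_eq0.
  rewrite -(Zl (a (tor t^-1) x)) ?lE; last exact: stZ.
  rewrite horner_poly rmorph_sum; apply: eq_bigr => i _.
  rewrite -((wK i).2 t^-1 x ti0) exprVn mulrC mulrA mulfV ?mul1r //.
  by rewrite expf_neq0.
by move/(congr1 (fun p : {poly k} => p`_j)); rewrite coef0 coef_poly ltn_ord.
Qed.

End BoundaryIdeal.

Section Transvectants.
Variables (k : closedFieldType) (X : affineVariety k) (a : SL2_action X).
Hypothesis char0 : [pchar k] =i pred0.
Implicit Types (x y : X) (g : SL2 k).

Variables (n : nat) (h : avcoord X) (H : nat -> avcoord X).
Hypothesis hH : forall g x, ev (a g x) h =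
  \sum_(j < n.+1) ev x (H j) * ma g ^+ (n - j) * mb g ^+ j.

Lemma form_up x t :
  ev (a (up t) x) h = (\poly_(j < n.+1) ev x (H j)).[t].
Proof.
rewrite hH horner_poly; apply: eq_bigr => j _.
by rewrite !upE expr1n mulr1.
Qed.

Lemma form_wlo x t :
  ev (a (wlo t) x) h = (\poly_(j < n.+1) ev x (H (n - j))).[t].
Proof.
rewrite hH horner_poly (reindex_inj rev_ord_inj); apply: eq_bigr => /= j _.
by rewrite subSS !wloE expr1n mulr1 subKn // -ltnS.
Qed.

Lemma form_coef_vanish x j : (forall g, ev (a g x) h = 0) -> (j <= n)%N ->
  ev x (H j) = 0.
Proof.
move=> hx jn; have : \poly_(j < n.+1) ev x (H j) = 0.
  by apply: poly_eq0_punctured => t _; rewrite -form_up hx.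
by move/(congr1 (fun p : {poly k} => p`_j)); rewrite coef0 coef_poly ltnS jn.
Qed.

(** The coefficient [H j] has torus weight n - 2j; this may be negative, so powers of t stand on
    both sides. *)
Lemma form_coef_tor x t j : t != 0 -> (j <= n)%N ->
  t ^+ n * ev (a (tor t) x) (H j) = t ^+ j.*2 * ev x (H j).
Proof.
move=> t0 jn; have : t ^+ n *: (\poly_(j < n.+1) ev (a (tor t) x) (H j)) =
    \poly_(j < n.+1) (t ^+ j.*2 * ev x (H j)).
  apply: poly_eq_punctured => s _.
  rewrite hornerZ -form_up act_mul hH horner_poly mulr_sumr.
  apply: eq_bigr => i _; rewrite !entriesM !upE !torE //.
  rewrite !(mulr0, mul1r, addr0, add0r) exprMn exprVn.
  rewrite -addnn exprD -{1}(@subnK i n) -1?ltnS // exprD.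
  by field; rewrite expf_neq0.
move/(congr1 (fun p : {poly k} => p`_j)).
by rewrite coefZ !coef_poly ltnS jn.
Qed.

(** The value at 0 of [transvectant n r] for the form dehomogenized along [wlo]: its derivative of
    order n - i at 0 is (n - i)! H_i. *)
Definition transv r : avcoord X := \sum_(i < r.+1)
  ((-1) ^+ i * ((n - i)`! * (n - (r - i))`!)%:R) *: (H i * H (r - i)).

Lemma ev_transv r x : (r <= n)%N -> ev x (transv r) =
  (transvectant n r (\poly_(j < n.+1) ev x (H (n - j)))).[0].
Proof.
move=> rn; rewrite /transvectant horner_sum rmorph_sum.
apply: eq_bigr => i _ /=.
have ir : (i <= r)%N by rewrite -ltnS.
rewrite evZ rmorphM /= hornerZ hornerM !horner_coef0 !coef_derivn !addn0.
rewrite !ffactnn !coef_poly !ltnS !leq_subr !subKn ?natrM; try lia.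
by rewrite -[in RHS]mulr_natr -[X in _ * (_ * X)]mulr_natr; ring.
Qed.

(** Acting by [lo s] shifts the dehomogenized form by s, which leaves its constant transvectant
    unchanged. Each product H_i H_(r-i) has weight (n - 2i) + (n - 2(r - i)). *)
Lemma transv_wt r : (r <= n)%N -> U_inv a h -> wt a (n - r).*2 (transv r).
Proof.
move=> rn Uh; split=> [s x|t x t0].
  rewrite !ev_transv //; set q := \poly_(j < n.+1) ev x (H (n - j)).
  have -> : \poly_(j < n.+1) ev (a (lo s) x) (H (n - j)) = q \Po ('X + s%:P).
    apply: poly_eq_punctured => t _.
    by rewrite horner_comp -form_wlo act_mul wloD form_wlo !hornerE.
  rewrite transvectant_shift horner_comp.
  rewrite [transvectant _ _ _]size1_polyC ?hornerC //.
  by rewrite transvectant_const // size_poly.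
apply: (mulfI (expf_neq0 r.*2 t0)).
rewrite mulrA -exprD -doubleD subnKC // -addnn exprD !rmorph_sum !mulr_sumr.
apply: eq_bigr => i _ /=; rewrite !evZ !rmorphM /=.
have ir : (i <= r)%N by rewrite -ltnS.
have E1 := form_coef_tor x t0 (leq_trans ir rn).
have E2 := form_coef_tor x t0 (leq_trans (leq_subr i r) rn).
have -> : r.*2 = (i.*2 + (r - i).*2)%N by lia.
rewrite exprD; set c : k := (-1) ^+ i * _.
transitivity (c * (t ^+ n * ev (a (tor t) x) (H i)) *
  (t ^+ n * ev (a (tor t) x) (H (r - i)))); first by ring.
by rewrite E1 E2; ring.
Qed.

(** Only the middle term i = e survives: in any other one of the indices i and 2e - i is below e.
    Its factorial coefficient is nonzero in characteristic 0. *)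
Lemma ev_transv_neq0 x e : (forall j, (j < e)%N -> ev x (H j) = 0) ->
  ev x (H e) != 0 -> ev x (transv e.*2) != 0.
Proof.
move=> He0 He; have e2 : (e < e.*2.+1)%N by lia.
rewrite rmorph_sum (bigD1 (Ordinal e2)) //= big1 ?addr0; last first.
  move=> i /eqP ie; rewrite evZ (rmorphM (ev x)) /=.
  have [ltie|leei] := ltnP i e.
    by rewrite He0 // mul0r mulr0.
  rewrite [ev x (H (_ - _))]He0 ?mulr0 //.
  suff : (i : nat) <> e by move: leei (ltn_ord i); lia.
  by move=> E; apply: ie; apply: val_inj.
rewrite evZ (rmorphM (ev x)) /=; have -> : (e.*2 - e)%N = e by lia.
rewrite !mulf_neq0 ?signr_eq0 // (pcharf0P _).1 //.
by rewrite muln_eq0 !eqn0Ngt !fact_gt0.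
Qed.

End Transvectants.

(** * A base point at which some form is a power of b *)

Section MonomialBase.
Variables (k : closedFieldType) (X : affineVariety k) (a : SL2_action X).
Hypothesis char0 : [pchar k] =i pred0.
Hypothesis dim1 : has_krull_dim (invariant_ring a (@Ubar k)) 1.
Implicit Types (h : avcoord X) (x y : X) (g : SL2 k).

(** Density in algebraic form: the orbit map of x embeds k[X] into k[SL_2]. *)
Definition orbit_dense x := forall h, (forall g, ev (a g x) h = 0) -> h = 0.

Lemma orbit_dense_act g x : orbit_dense x -> orbit_dense (a g x).
Proof.
move=> dx h hx; apply: dx => g'.
by rewrite -(hx (g' * g^-1)%g) -actM mulgVK.
Qed.

Lemma orbit_eq x h h' : orbit_dense x ->
  (forall g, ev (a g x) h = ev (a g x) h') -> h = h'.
Proof.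
move=> dx hh'; apply/eqP; rewrite -subr_eq0; apply/eqP/dx => g.
by rewrite rmorphB /= hh' subrr.
Qed.

Lemma orbit_neq0 x h : orbit_dense x -> h != 0 -> exists g, ev (a g x) h != 0.
Proof.
move=> dx h0; apply: contrapT => hx; case/eqP: h0; apply: dx => g.
by apply: contrapT => /eqP hg; apply: hx; exists g.
Qed.

(* The transvectant of order 2e is nonzero at x, where h vanishes; but a power
   of h is proportional to a power of it, unless it is a constant, which is
   then 0 because it vanishes at y. *)
Lemma no_small_order n h (H : nat -> avcoord X) x y e :
    orbit_dense x -> wt a n h -> h != 0 ->
    (forall g z, ev (a g z) h =
       \sum_(j < n.+1) ev z (H j) * ma g ^+ (n - j) * mb g ^+ j) ->
    (forall g, ev (a g y) h = 0) -> (0 < e)%N -> (e.*2 <= n)%N ->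
    (forall j, (j < e)%N -> ev x (H j) = 0) -> ev x (H e) != 0 ->
  False.
Proof.
move=> dx wh h0 hH hy e0 en He0 He.
have Tx : ev x (transv n H e.*2) != 0 by apply: ev_transv_neq0.
have wT := transv_wt char0 hH en wh.1.
have Ty : ev y (transv n H e.*2) = 0.
  rewrite rmorph_sum big1 // => i _ /=; rewrite evZ (rmorphM (ev y)) /=.
  rewrite (form_coef_vanish hH hy); first by rewrite mul0r mulr0.
  by rewrite (leq_trans _ en) // -ltnS.
have [r0|rN0] := eqVneq (n - e.*2).*2 0%N.
  rewrite r0 in wT; have [K TK] := wt_binary_form wT.
  case/negP: Tx; rewrite -(ev_alg y (ev x _)); apply/eqP.
  rewrite -[RHS]Ty; congr (ev y _); apply: (orbit_eq dx) => g.
  rewrite ev_alg -[in LHS](act1 a x) !TK !big_ord1.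
  by rewrite !expr0.
have TN0 : transv n H e.*2 != 0 by apply: contraNneq Tx => ->; rewrite rmorph0.
have [|c hc] := wt_krull_dim1 dim1 wh wT TN0; first by rewrite lt0n.
have hx : ev x h = 0.
  rewrite -(act1 a x) hH big_ord_recl He0 // ma1 mb1 !mul0r add0r.
  by rewrite big1 // => i _; rewrite expr0n mulr0.
have := congr1 (ev x) hc; rewrite evZ !rmorphXn /= hx expr0n (negPf rN0).
move/esym/eqP; rewrite mulf_eq0 expf_eq0 (negPf Tx) andbF orbF => /eqP c0.
by move/eqP: hc; rewrite c0 scale0r expf_eq0 (negPf h0) andbF.
Qed.

(** Z will be the complement of the open orbit. A weight vector vanishing on Z gives a form whose
    roots cannot have multiplicity at most n/2, by [no_small_order]; so there is a single root,
    which is moved to 0. *)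
Lemma boundary_monomial (Z : set X) x0 y h :
    orbit_dense x0 -> (forall g x, Z x -> Z (a g x)) -> Z y ->
    h != 0 -> (forall x, Z x -> ev x h = 0) ->
  exists n x1 h', [/\ (0 < n)%N, orbit_dense x1 &
    forall g, ev (a g x1) h' = mb g ^+ n].
Proof.
move=> dx0 stZ Zy h0 Zh.
have {h h0 Zh}[n [h [wh h0 Zh]]] := boundary_wt stZ h0 Zh.
have [H hH] := wt_binary_form wh.
have [g0 hg0] := orbit_neq0 dx0 h0.
(* With this choice H_n(x) = h(g0 x0) != 0, so the dehomogenized form p at x has degree exactly n:
   no root lies at infinity. *)
pose x := a ((wlo 0)^-1 * g0)%g x0.
have dx : orbit_dense x by apply: orbit_dense_act.
have Hn : ev x (H n) != 0.
  move: hg0; have -> : a g0 x0 = a (wlo 0) x by rewrite -actM mulVKg.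
  rewrite hH big_ord_recr big1 /= => [|i _].
    by rewrite add0r subnn !wloE expr1n expr0 !mulr1.
  by rewrite !wloE expr0n subn_eq0 leqNgt ltn_ord mulr0 mul0r.
pose p := \poly_(j < n.+1) ev x (H j).
have sp : size p = n.+1 by rewrite size_poly_eq.
(* A form of degree 0 is constant on the dense orbit, hence on X, and its value at y is 0. *)
have n0 : (0 < n)%N.
  rewrite lt0n; apply: contraNneq Hn => n0.
  have hE g z : ev (a g z) h = ev z (H 0).
    by rewrite hH n0 big_ord1 subnn !expr0 !mulr1.
  have -> : H n = 0; last by rewrite rmorph0.
  rewrite n0; apply: (orbit_eq dx) => g.
  rewrite -(hE g^-1%g) actK -[in LHS](act1 a x) hE rmorph0.
  rewrite -(ev_alg y (ev x (H 0))) -[RHS](Zh y Zy); congr (ev y _).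
  by apply: (orbit_eq dx) => g'; rewrite ev_alg hE.
(* Replacing x by [up rho] x translates p by rho, which carries the root rho to 0. *)
have shiftp rho j : (j <= n)%N ->
    ev (a (up rho) x) (H j) = (p \Po ('X + rho%:P))`_j.
  move=> jn; have <- : \poly_(j < n.+1) ev (a (up rho) x) (H j) =
      p \Po ('X + rho%:P).
    apply: poly_eq_punctured => t _.
    rewrite horner_comp -(form_up hH) act_mul upD (form_up hH).
    by rewrite !hornerE.
  by rewrite coef_poly ltnS jn.
have Xshift (rho : k) : ('X - rho%:P) \Po ('X + rho%:P) = 'X.
  by rewrite comp_polyB comp_polyX comp_polyC addrK.
have comp_exp (q r : {poly k}) i : (q ^+ i) \Po r = (q \Po r) ^+ i.
  by rewrite -[LHS]/(comp_poly r (q ^+ i)) rmorphXn.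
have [[rho [c pE]]|[rho [e [u [pE ur e0 en]]]]] :=
  small_multiplicity_root sp n0.
  have c0 : c != 0.
    by apply: contraTneq (ltn0Sn n) => c0; rewrite -sp pE c0 scale0r size_poly0.
  exists n, (a (up rho) x), (c^-1 *: h); split=> // [|g].
    exact: orbit_dense_act.
  rewrite evZ hH big_ord_recr big1 /= => [|i _]; last first.
    rewrite shiftp 1?ltnW // pE comp_polyZ comp_exp Xshift coefZ coefXn.
    by rewrite ltn_eqF // mulr0 !mul0r.
  rewrite add0r subnn expr0 mulr1 shiftp // pE comp_polyZ comp_exp Xshift.
  by rewrite coefZ coefXn eqxx mulr1 mulKf.
have pE' : p \Po ('X + rho%:P) = (u \Po ('X + rho%:P)) * 'X^e.
  by rewrite pE comp_polyM comp_exp Xshift.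
have en' : (e <= n)%N by rewrite (leq_trans _ en) // -addnn leq_addr.
exfalso; apply: (@no_small_order n h H (a (up rho) x) y e) => //.
- exact: orbit_dense_act.
- by move=> g; apply: Zh; apply: stZ.
- by move=> j je; rewrite shiftp ?(leq_trans (ltnW je)) // pE' coefMXn je.
- rewrite shiftp // pE' coefMXn ltnn subnn -horner_coef0 horner_comp.
  by rewrite !hornerE -rootE.
Qed.

End MonomialBase.

(** * The stabilizer of the base point *)

Section MonomialOrbit.
Variables (k : closedFieldType) (X : affineVariety k) (a : SL2_action X).
Hypothesis char0 : [pchar k] =i pred0.
Hypothesis dim1 : has_krull_dim (invariant_ring a (@Ubar k)) 1.
Hypothesis normX : normal_variety X.
Variables (x0 : X) (n0 : nat) (h0 : avcoord X).
Hypothesis n0_gt0 : (0 < n0)%N.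
Hypothesis dx0 : orbit_dense a x0.
Hypothesis h0E : forall g, ev (a g x0) h0 = mb g ^+ n0.
Implicit Types (h : avcoord X) (x y : X) (g : SL2 k).

Lemma wt_monomial_base : wt a n0 h0.
Proof.
split=> [s|t] x; move: x.
  have [h' h'E] := translate_ex a (lo s) h0.
  move=> x; rewrite -h'E; congr (ev x _); apply: (orbit_eq dx0) => g.
  by rewrite h'E act_mul !h0E entriesM !loE mul1r mul0r addr0.
move=> x t0; have [h' h'E] := translate_ex a (tor t) h0.
rewrite -h'E -evZ; congr (ev x _); apply: (orbit_eq dx0) => g.
rewrite evZ h'E act_mul !h0E entriesM !torE // mul0r addr0 exprMn mulrA.
by rewrite -exprMn mulfV // expr1n mul1r.
Qed.

(** A power of h is proportional to a power of [h0]. The dehomogenized form p then satisfies p^n0 =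
    c t^(n0 n), so for c != 0 it divides a power of t and is itself a monomial. *)
Lemma wt_monomial n h : wt a n h ->
  exists c, forall g, ev (a g x0) h = c * mb g ^+ n.
Proof.
move=> wh; have h0N0 : h0 != 0.
  apply: contra_eqN (h0E (wlo 0)) => /eqP->.
  by rewrite rmorph0 wloE expr1n eq_sym oner_neq0.
have [c hc] := wt_krull_dim1 dim1 wh wt_monomial_base h0N0 n0_gt0.
have [H hH] := wt_binary_form wh.
have [c0|cN0] := eqVneq c 0.
  exists 0 => g; move/eqP: hc; rewrite c0 scale0r expf_eq0 n0_gt0 => /eqP->.
  by rewrite mul0r rmorph0.
pose p := \poly_(j < n.+1) ev x0 (H j).
have pE : p ^+ n0 = c *: 'X^(n0 * n).
  apply: poly_eq_punctured => t _; rewrite hornerZ hornerXn horner_exp.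
  rewrite -(form_up hH) -rmorphXn /= hc evZ rmorphXn /= h0E upE.
  by rewrite -exprM.
have [l _ pl] : exists2 l, (l <= n0 * n)%N & p %= ('X - 0%:P) ^+ l.
  apply/dvdp_exp_XsubCP; rewrite subr0 -(dvdpZr _ _ cN0) -pE.
  by rewrite -(prednK n0_gt0) exprS dvdp_mulr.
have /eqpfP : p %= 'X^l by rewrite subr0 in pl.
set d := _ / _ => pd; have dN0 : d != 0.
  apply: contraNneq cN0 => d0; move/eqP: pE.
  rewrite pd d0 scale0r expr0n eqn0Ngt n0_gt0 eq_sym scaler_eq0.
  by rewrite (negPf (monic_neq0 (monicXn _ _))) orbF.
have ln : l = n.
  have /(congr1 (fun q : {poly k} => size q)) := pE.
  rewrite pd exprZn -exprM !size_scale ?expf_neq0 // !size_polyXn => -[/eqP].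
  by rewrite mulnC eqn_pmul2l // => /eqP.
exists d => g; rewrite hH big_ord_recr big1 /= => [|i _].
  rewrite add0r subnn expr0 mulr1; congr (_ * _).
  have := congr1 (fun q : {poly k} => q`_n) pd.
  by rewrite coef_poly ltnSn coefZ coefXn ln eqxx mulr1.
have := congr1 (fun q : {poly k} => q`_i) pd.
rewrite coef_poly ltnW ?ltnS // coefZ coefXn ln ltn_eqF // mulr0 => ->.
by rewrite !mul0r.
Qed.

Definition monomial_degree j := exists h, forall g, ev (a g x0) h = mb g ^+ j.

Lemma monomial_degree0 : monomial_degree 0.
Proof. by exists 1 => g; rewrite rmorph1. Qed.

Lemma monomial_degreeD i j :
  monomial_degree i -> monomial_degree j -> monomial_degree (i + j).
Proof.
move=> [h hE] [h' h'E]; exists (h * h') => g.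
by rewrite rmorphM /= hE h'E exprD.
Qed.

(* The quotient of b^j by b^i lies in the fraction field of k[X], and its n0-th
   power b^(n0 (j - i)) lies in k[X]. *)
Lemma monomial_degreeB i j : (i <= j)%N ->
  monomial_degree i -> monomial_degree j -> monomial_degree (j - i).
Proof.
move=> ij [hi hiE] [hj hjE].
have hi0 : hi != 0.
  apply: contra_eqN (hiE (wlo 0)) => /eqP->.
  by rewrite rmorph0 wloE expr1n eq_sym oner_neq0.
have E : hj ^+ n0 = h0 ^+ (j - i) * hi ^+ n0.
  apply: (orbit_eq dx0) => g; rewrite rmorphM !rmorphXn /= hiE hjE h0E.
  by rewrite -!exprM -exprD -[(i * _)%N]mulnC -mulnDr subnK // mulnC.
have [|w wE] := normX (u := tofrac hj / tofrac hi).
  exists ('X^n0 - (h0 ^+ (j - i))%:P); first exact: monicXnsubC.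
  rewrite rootE rmorphB /= map_polyXn map_polyC /= !hornerE.
  rewrite expr_div_n -!tofracXn E tofracM mulfK ?subrr //.
  by rewrite tofrac_eq0 expf_neq0.
have hw : hj = w * hi.
  apply/eqP; rewrite -tofrac_eq tofracM -wE divfK //.
  by rewrite tofrac_eq0.
exists w; apply: kSL2_eq_mb => [||g b0].
- exact: orbit_map_kSL2.
- exact/generatedX/kSL2_mb.
apply: (mulIf (expf_neq0 i b0)); rewrite -exprD subnK // -hjE hw.
by rewrite rmorphM /= hiE.
Qed.

(** The set of degrees contains n0 > 0 and is closed under sums and differences, so by Euclidean
    division it consists of the multiples of its least positive element. *)
Lemma monomial_degree_gcd : exists f, (0 < f)%N /\
  forall j, monomial_degree j <-> (f %| j)%N.
Proof.
have exS : exists f, (0 < f)%N && `[< monomial_degree f >].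
  by exists n0; rewrite n0_gt0; apply/asboolP; exists h0.
case: (ex_minnP exS) => f /andP[f0 /asboolP Sf] fmin.
have Sm q : monomial_degree (q * f).
  elim: q => [|q IHq]; first exact: monomial_degree0.
  by rewrite mulSn; apply: monomial_degreeD.
exists f; split=> // j; split=> [Sj|/dvdnP[q ->]]; last exact: Sm.
rewrite /dvdn; apply: contraTT (ltn_pmod j f0) => r0.
rewrite -leqNgt; apply: fmin; rewrite lt0n r0; apply/asboolP.
have -> : (j %% f = j - j %/ f * f)%N by rewrite {2}(divn_eq j f) addKn.
by apply: monomial_degreeB => //; apply: leq_trunc_div.
Qed.

(** Left translation by [up t] turns b^j into (b + t d)^j; the coefficient of t^i lies in k[X], and
    its binomial factor is invertible in characteristic 0. *)
Lemma monomial_degree_polarize j i : monomial_degree j -> (i <= j)%N ->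
  exists h, forall g, ev (a g x0) h = mb g ^+ (j - i) * md g ^+ i.
Proof.
move=> [h hE] ij; have [H hH] := act_up a h.
have C0 : 'C(j, i)%:R != 0 :> k.
  by rewrite (pcharf0P _).1 // -lt0n bin_gt0.
exists ('C(j, i)%:R^-1 *: H`_i) => g.
have HE : map_poly (ev (a g x0)) H =
    \poly_(l < j.+1) (mb g ^+ (j - l) * md g ^+ l *+ 'C(j, l)).
  apply: poly_eq_punctured => t _.
  rewrite -hH act_mul hE entriesM !upE mul1r exprDn horner_poly.
  by apply: eq_bigr => l _; rewrite mulrnAl exprMn; congr (_ *+ _); ring.
have := congr1 (fun q : {poly k} => q`_i) HE.
rewrite coef_map coef_poly ltnS ij evZ /= => ->.
by rewrite -[X in _ * X]mulr_natl mulKf.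
Qed.

(* For h in k[X], the lower unipotent substitution s = -d/b in h (lo s g x0),
   cleared of denominators by b^N, is an invariant K of Ubar in k[X]; hence K
   is a combination of powers of b^f. *)
Lemma monomial_stabilizer f s z : (0 < f)%N ->
    (forall j, monomial_degree j <-> (f %| j)%N) -> z ^+ f = 1 ->
  a (lo s * tor z)%g x0 = x0.
Proof.
move=> f0 Sf zf; have z0 : z != 0.
  exact: unity_neq0 f0 zf.
(* Both matrices have d = 0, where the substitution -d/b is trivial and K is b^N h; their entries b
   are z and 1. *)
suff E : a (wlo s * tor z)%g x0 = a (wlo 0) x0.
  rewrite -[RHS](actK a (wlo 0)) -E act_mul -[s]add0r -wloD -mulgA.
  by rewrite mulKg add0r.
apply: ev_point_inj => h; have [H hH] := act_lo a h.
(* A multiple of f, so that b^N and its polarizations b^(N - i) d^i lie in k[X], and large enough to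
   clear all denominators; also z^N = 1. *)
pose N := (f * size H)%N.
have HN : (size H <= N)%N by rewrite leq_pmull.
have SN : monomial_degree N by apply/Sf; apply: dvdn_mulr.
have exB i : exists h', (i <= N)%N ->
    forall g, ev (a g x0) h' = mb g ^+ (N - i) * md g ^+ i.
  have [iN|] := leqP i N; last by exists 0.
  by have [h' h'E] := monomial_degree_polarize SN iN; exists h'.
have {exB}[B BE] := choice exB.
pose K := \sum_(i < size H) (-1) ^+ i *: (H`_i * B i).
have KE g : mb g != 0 ->
    ev (a g x0) K = mb g ^+ N * ev (a (lo (- (md g / mb g)) * g)%g x0) h.
  move=> b0; rewrite actM hH (horner_coef_wide (n := size H)) ?size_poly //.
  rewrite rmorph_sum mulr_sumr; apply: eq_bigr => i _ /=.
  have iN : (i <= N)%N by rewrite ltnW // (leq_trans (ltn_ord i)).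
  rewrite evZ (rmorphM (ev _)) /= BE // coef_map /=.
  rewrite -[in RHS](subnK iN) exprD [in RHS]exprNn expr_div_n.
  by field; rewrite expf_neq0.
have UK : U_inv a K.
  move=> s' x; have [K' K'E] := translate_ex a (lo s') K.
  rewrite -K'E; congr (ev x _); apply: (orbit_eq dx0).
  apply: kSL2_eq_mb => [||g b0]; try exact: orbit_map_kSL2.
  have bE : mb (lo s' * g)%g = mb g by rewrite entriesM !loE mul1r mul0r addr0.
  rewrite K'E act_mul (KE _ b0) KE ?bE // mulgA loD entriesM !loE mul1r.
  congr (_ * ev (a (lo _ * g)%g x0) h); field; exact: b0.
have [n [Kj [KjE wK]]] := U_inv_decomposition UK.
(* Each nonzero component of K is a multiple of some b^j with f dividing j, and z^j = 1. *)
have Kz g g' : mb g = z -> mb g' = 1 -> ev (a g x0) K = ev (a g' x0) K.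
  move=> bz b1; rewrite KjE !rmorph_sum; apply: eq_bigr => j _ /=.
  have [c cE] := wt_monomial (wK j); rewrite !cE bz b1 expr1n.
  have [->|c0] := eqVneq c 0; first by rewrite !mul0r.
  have /Sf/dvdnP[q ->] : monomial_degree j.
    exists (c^-1 *: Kj j) => g1; rewrite evZ cE mulKf //.
  by rewrite mulnC exprM zf expr1n.
have bz : mb (wlo s * tor z)%g = z.
  by rewrite entriesM !wloE !torE // mulr0 add0r mul1r.
have dz : md (wlo s * tor z)%g = 0.
  by rewrite entriesM !wloE !torE // mulr0 add0r mul0r.
have := Kz _ _ bz (wloE 0).1.2; rewrite !KE ?bz ?dz ?wloE ?oner_neq0 //.
by rewrite !mul0r oppr0 lo0 !mul1g exprM zf !expr1n !mul1r.
Qed.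

End MonomialOrbit.

(** * Right invariants of k[SL_2] *)

Section RightInvariants.
Variable k : closedFieldType.
Hypothesis char0 : [pchar k] =i pred0.

(** In characteristic 0 there are f distinct f-th roots of unity. They are all roots of X^(m mod f)
    - 1, whose degree is below f, so m mod f is 0. *)
Lemma unity_roots_dvdn f m : (0 < f)%N ->
  (forall z : k, z ^+ f = 1 -> z ^+ m = 1) -> (f %| m)%N.
Proof.
move=> f0 zfm; apply: contraT => r0.
have [rs rsE] := closed_field_poly_normal ('X^f - 1 : {poly k}).
have lc1 : lead_coef ('X^f - 1 : {poly k}) = 1.
  by apply/monicP; rewrite -polyC1 monicXnsubC.
rewrite lc1 scale1r in rsE.
have urs : uniq rs.
  rewrite -separable_prod_XsubC -rsE separable_Xn_sub_1 //.
  by rewrite (pcharf0P _).1 // -lt0n.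
have srs : size rs = f.
  apply: succn_inj; rewrite -(size_prod_XsubC rs id) -rsE.
  by rewrite -polyC1 size_XnsubC.
have rf := ltn_pmod m f0.
have : (size rs < size ('X^(m %% f) - 1 : {poly k})%R)%N.
  apply: max_poly_roots => //.
    by rewrite monic_neq0 // -polyC1 monicXnsubC // lt0n.
  apply/allP => z zrs; have : root ('X^f - 1) z by rewrite rsE root_prod_XsubC.
  rewrite !rootE !hornerE !subr_eq0 => /eqP zf.
  have := zfm z zf; rewrite {1}(divn_eq m f) exprD mulnC exprM zf expr1n mul1r.
  by move/eqP.
by rewrite -polyC1 size_XnsubC ?lt0n // srs ltnS leqNgt rf.
Qed.

Lemma mu_UbarP f g : mu_Ubar f g <->
  exists z s : k, [/\ z != 0, z ^+ f = 1 & g = (tor z * lo s)%g].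
Proof.
split=> [[t [u [[[z z0 [ta tb tc td]] tf] [ua ub ud] ->]]]|[z [s [z0 zf ->]]]].
  have tE : t = tor z by apply: SL2P; rewrite torE.
  exists z, (mc u); split=> //; last first.
    by congr (_ * _)%g => //; apply: SL2P; rewrite loE.
  move: tf; rewrite tE torX // => /(congr1 (@md k)).
  by rewrite torE ?expf_neq0 // md1.
exists (tor z), (lo s); split=> //; last by split; rewrite loE.
by split; [exists z; rewrite ?torE | rewrite torX // zf tor1].
Qed.

(** The inner variable stands for b and the outer one for d. *)
Definition eval2 (bd : k * k) : {rmorphism {poly {poly k}} -> k} :=
  horner_eval bd.1 \o horner_eval bd.2%:P.

Lemma eval2E b d (Q : {poly {poly k}}) : eval2 (b, d) Q = Q.[d%:P].[b].
Proof. by []. Qed.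

Lemma eval2_coef b d (Q : {poly {poly k}}) n : (size Q <= n)%N ->
  eval2 (b, d) Q = \sum_(j < n) (Q`_j).[b] * d ^+ j.
Proof.
move=> Qn; rewrite eval2E (horner_coef_wide _ Qn) horner_sum.
by apply: eq_bigr => j _; rewrite hornerM -polyC_exp hornerC.
Qed.

Lemma eval2_eq (Q Q' : {poly {poly k}}) :
  (forall b d, b != 0 -> d != 0 -> eval2 (b, d) Q = eval2 (b, d) Q') -> Q = Q'.
Proof.
move=> QQ'; apply/polyP => j; apply: poly_eq_punctured => b b0.
pose n := maxn (maxn (size Q) (size Q')) j.+1.
have : \poly_(i < n) (Q`_i).[b] = \poly_(i < n) (Q'`_i).[b].
  apply: poly_eq_punctured => d d0; rewrite !horner_poly.
  by rewrite -!eval2_coef ?QQ' // /n; lia.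
move/(congr1 (fun q : {poly k} => q`_j)); rewrite !coef_poly.
by have -> : (j < n)%N by rewrite /n; lia.
Qed.

Lemma generated_trans m n (u : 'I_m -> SL2fun k) (v : 'I_n -> SL2fun k) F :
  (forall i, generated v (u i)) -> generated u F -> generated v F.
Proof.
move=> vu [P FP]; have [Q uQ] := choice vu.
exists (P \mPo [tuple Q i | i < m]) => x; rewrite FP comp_mpoly_meval.
by apply: meval_eq => i; rewrite tnth_mktuple uQ.
Qed.

Lemma Rinf_monomial f i j : (f %| i + j)%N ->
  Rinf f (fun x : SL2 k => mb x ^+ i * md x ^+ j).
Proof.
case/dvdnP => q; elim: q i j => [|q IHq] i j E.
  have [-> ->] : i = 0%N /\ j = 0%N by lia.
  under eq_fun do rewrite !expr0 mulr1.
  exact: generated_cst.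
(* Splits off one generator b^i' d^j', with i' + j' = f. *)
have [i' [j' [fE iE jE]]] :
    exists i' j', [/\ f = (i' + j')%N, (i' <= i)%N & (j' <= j)%N].
  by exists (f - minn j f)%N, (minn j f); split; lia.
have j'f : (j' < f.+1)%N by lia.
have gE (x : SL2 k) : mb x ^+ i * md x ^+ j =
    (md x ^+ (Ordinal j'f) * mb x ^+ (f - Ordinal j'f)) *
    (mb x ^+ (i - i') * md x ^+ (j - j')).
  rewrite /= {1}fE addnK -{1}(subnK iE) -{1}(subnK jE) !exprD; ring.
under eq_fun do rewrite gE.
apply: generatedM; first exact: (generated_gen _ (Ordinal j'f)).
by apply: IHq; lia.
Qed.

(** A right [Ubar]-invariant depends only on the second column (b, d). Being regular where b != 0
    and where d != 0, it is a polynomial in b and d; invariance under [mu f] leaves only the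
    monomials of total degree divisible by f. *)
Lemma right_invariants_mu_Ubar f : (0 < f)%N ->
  right_invariants (@mu_Ubar k f) = Rinf f.
Proof.
move=> f0; apply/seteqP; split=> [h [kh hi]|h Rh]; last first.
  split.
    apply: generated_trans Rh => i; apply: generatedM; apply: generatedX.
      exact: kSL2_md.
    exact: kSL2_mb.
  move=> g x /mu_UbarP[z [s [z0 zf ->]]]; have [P hP] := Rh.
  rewrite !hP; apply: meval_eq => i.
  rewrite !entriesM !torE // !loE !(mulr0, mulr1, addr0, add0r) !exprMn.
  rewrite mulrACA mulrC -[RHS]mul1r -zf; congr (_ * _).
  by rewrite -exprD subnKC // -ltnS.
have hlo s x : h (x * lo s)%g = h x.
  apply: hi; apply/mu_UbarP; exists 1, s; rewrite oner_neq0 expr1n tor1 mul1g.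
  by split.
have htor z x : z ^+ f = 1 -> h (x * tor z)%g = h x.
  move=> zf; apply: hi; apply/mu_UbarP; exists z, 0.
  rewrite lo0 mulg1; split=> //.
  exact: unity_neq0 f0 zf.
(* The maps [g1] and [g2] are sections of the second column over b != 0 and over d != 0; where both
   exist they differ by a right factor in [Ubar]. *)
pose g1 (bd : k * k) := sl2 0 bd.1 (- bd.1^-1) bd.2.
have g1E b d : b != 0 -> [/\ ma (g1 (b, d)) = 0, mb (g1 (b, d)) = b,
    mc (g1 (b, d)) = - b^-1 & md (g1 (b, d)) = d].
  by move=> b0; apply: sl2E; rewrite mul0r sub0r mulrN opprK mulfV.
pose g2 (bd : k * k) := sl2 bd.2^-1 bd.1 0 bd.2.
have g2E b d : d != 0 -> [/\ ma (g2 (b, d)) = d^-1, mb (g2 (b, d)) = b,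
    mc (g2 (b, d)) = 0 & md (g2 (b, d)) = d].
  by move=> d0; apply: sl2E; rewrite mulr0 subr0 mulVf.
have eX b d : eval2 (b, d) 'X = d by rewrite eval2E hornerX hornerC.
have eC b d q : eval2 (b, d) q%:P = q.[b] by rewrite eval2E hornerC.
have [||M [Q hQ]] := @kSL2_param k _ (fun bd => bd.1 != 0) _
    (fun c => c%:P%:P) eval2 'X%:P g1 0 ('X * 'X)%:P (- 1) ('X%:P * 'X)
    h _ _ kh.
- by move=> [b d] c; rewrite eC hornerC.
- move=> [b d] b0; rewrite !eval2E !hornerE; have [-> -> -> ->] := g1E b d b0.
  by split=> //; rewrite ?mulr0 // mulrN mulfV.
have [||M' [Q' hQ']] := @kSL2_param k _ (fun bd => bd.2 != 0) _
    (fun c => c%:P%:P) eval2 'X g2 1 ('X%:P * 'X) 0 ('X * 'X) h _ _ kh.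
- by move=> [b d] c; rewrite eC hornerC.
- move=> [b d] d0; rewrite !eval2E !hornerE; have [-> -> -> ->] := g2E b d d0.
  by split=> //; rewrite ?mulr0 ?mulfV // mulrC.
have QQ' : 'X^M' * Q = ('X^M)%:P * Q'.
  apply: eval2_eq => b d b0 d0; rewrite !eval2E !hornerM !hornerXn !hornerC.
  rewrite -!polyC_exp !hornerC hornerXn -!eval2E.
  have := hQ (b, d) b0; have := hQ' (b, d) d0; rewrite eX eC hornerX => <- <-.
  rewrite mulrCA; congr (_ * (_ * _)).
  have [a2 b2 c2 d2] := g2E b d d0; have [a1 b1 c1 d1] := g1E b d b0.
  rewrite -(hlo (b * d)^-1 (g1 _)); congr h; apply: SL2P;
    rewrite !entriesM !loE ?a1 ?b1 ?c1 ?d1 ?a2 ?b2 ?c2 ?d2; field;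
    by rewrite ?b0 ?d0 ?oner_neq0.
(* From d^M' Q = b^M Q', with b and d coprime, R is the quotient of Q' by d^M', and Q = b^M R. *)
pose R := drop_poly M' Q'.
have QR : Q = ('X^M)%:P * R.
  apply/polyP => j; rewrite coefCM coef_drop_poly.
  have := congr1 (fun q : {poly {poly k}} => q`_(j + M')) QQ'.
  by rewrite coefXnM coefCM ltnNge leq_addl /= addnK.
have hR b d : b != 0 -> h (g1 (b, d)) = eval2 (b, d) R.
  move=> b0; apply: (mulfI (expf_neq0 M b0)).
  have := hQ (b, d) b0; rewrite eC hornerX => ->.
  by rewrite QR !eval2E hornerM hornerC hornerM hornerXn.
pose n := size R.
(* Right multiplication by [tor z] scales the column (b, d) by z, so R(z b, z d) = R(b, d). *)
have Rcoef z i j : z ^+ f = 1 -> R`_j`_i * z ^+ (i + j) = R`_j`_i.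
  move=> zf; have z0 : z != 0.
    exact: unity_neq0 f0 zf.
  pose Rz := \poly_(j < n) \poly_(i < size R`_j) (R`_j`_i * z ^+ (i + j)).
  suff RzR : Rz = R.
    have := congr1 (fun q : {poly {poly k}} => q`_j`_i) RzR; rewrite coef_poly.
    case: ltnP => [_|nj]; last by rewrite coef0 (nth_default _ nj) coef0 mul0r.
    by rewrite coef_poly; case: ltnP => // sR; rewrite nth_default // mul0r.
  apply: eval2_eq => b d b0 d0.
  have zb0 : z * b != 0 by rewrite mulf_neq0.
  transitivity (eval2 (z * b, z * d) R).
    rewrite (eval2_coef _ _ (size_poly _ _)) (eval2_coef _ _ (leqnn _)).
    apply: eq_bigr => l _; rewrite coef_poly ltn_ord horner_poly horner_coef.
    rewrite !mulr_suml; apply: eq_bigr => i' _; rewrite exprD !exprMn; ring.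
  rewrite -!hR // -[RHS](htor z) //; congr h.
  have [a2 b2 c2 d2] := g1E (z * b) (z * d) zb0.
  have [a1 b1 c1 d1] := g1E b d b0.
  by apply: SL2P; rewrite !entriesM !torE // ?a1 ?b1 ?c1 ?d1 ?a2 ?b2 ?c2 ?d2;
    field; rewrite ?b0 ?z0.
have hE : h = fun x => \sum_(j < n) \sum_(i < size R`_j)
    R`_j`_i * (mb x ^+ i * md x ^+ j).
  apply/funext/kSL2_eq_mb => // [|g b0].
    apply: generated_sum => j; apply: generated_sum => i.
    apply: generatedM; first exact: generated_cst.
    by apply: generatedM; apply: generatedX; [exact: kSL2_mb | exact: kSL2_md].
  have [a1 b1 c1 d1] := g1E (mb g) (md g) b0.
  transitivity (h (g1 (mb g, md g))).
    rewrite -[RHS](hlo (ma g / mb g)); congr h.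
    by apply: SL2P; rewrite ?(mcE b0) ?entriesM ?loE ?a1 ?b1 ?c1 ?d1; field;
      rewrite ?b0 ?oner_neq0.
  rewrite hR // (eval2_coef _ _ (leqnn _)); apply: eq_bigr => j _.
  by rewrite horner_coef mulr_suml; apply: eq_bigr => i _; rewrite mulrA.
rewrite hE; apply: generated_sum => j; apply: generated_sum => i.
have [->|Rji] := eqVneq R`_j`_i 0; first by exists 0 => x; rewrite mul0r meval0.
apply: generatedM; first exact: generated_cst.
apply: Rinf_monomial; apply: unity_roots_dvdn => // z zf.
by apply: (mulfI Rji); rewrite Rcoef // mulr1.
Qed.

End RightInvariants.

(** * The equivariant isomorphism *)

Section AlgebraMorphisms.
Variables (k : fieldType) (A : comAlgType k).

Section Build.
Variable phi : A -> k^o.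
Hypotheses (phi_linear : linear phi) (phi_monoid : monoid_morphism phi).

Let psi := phi.
HB.instance Definition _ := GRing.isLinear.Build k A k^o _ psi phi_linear.
HB.instance Definition _ := GRing.isMonoidMorphism.Build A k^o psi phi_monoid.

Lemma lrmorphism_ex : exists xi : {lrmorphism A -> k^o}, xi =1 phi.
Proof. by exists psi. Qed.

End Build.

(** Beyond the function, the packed morphism contains only proofs, which are equal by proof
    irrelevance. *)
Lemma lrmorphism_eq (xi xi' : {lrmorphism A -> k^o}) : xi =1 xi' -> xi = xi'.
Proof.
move=> /funext; case: xi xi' => [f cf] [f' cf'] /= ff'; rewrite -ff' in cf' *.
congr GRing.LRMorphism.Pack.
case: cf cf' => [[p1] [p2] [p3]] [[q1] [q2] [q3]].
by congr GRing.LRMorphism.Class; congr (_ _); apply: Prop_irrelevance.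
Qed.

End AlgebraMorphisms.

Lemma right_invariant_lift (k : fieldType) (H : set (SL2 k)) (F : SL2fun k) :
  right_invariants H F -> exists r : right_invariant_ring H, val r = F.
Proof.
move=> Fi; have Fi' : F \in right_invariant_pred H by apply/asboolP.
by exists (exist (fun h => h \in right_invariant_pred H) F Fi').
Qed.

(** * Comparison of X with the quotient by mu_f and Ubar *)

Section QuotientModel.
Variables (k : closedFieldType) (X : affineVariety k) (a : SL2_action X).
Hypothesis char0 : [pchar k] =i pred0.
Implicit Types (h : avcoord X) (x : X) (g : SL2 k) (f : nat).

(* Through the orbit map g |-> g x, the algebra k[X] is the algebra of right
   (mu_f |x Ubar)-invariants of k[SL_2]. *)
Definition model_at f x := orbit_dense a x /\
  forall F : SL2fun k, (exists h, forall g, ev (a g x) h = F g) <->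
                       right_invariants (@mu_Ubar k f) F.

Lemma model_ex : normal_variety X -> has_open_dense_orbit a ->
    ~ homogeneous a -> has_krull_dim (invariant_ring a (@Ubar k)) 1 ->
  exists f x, (0 < f)%N /\ model_at f x.
Proof.
move=> nX [x0 [[S SE] dX]] nhom dim1.
have dx0 : orbit_dense a x0.
  move=> h hx; apply: ev_inj => x; rewrite rmorph0.
  have := dX [set z : X | ev z h = 0].
  have hZ : zariski_closed [set z : X | ev z h = 0].
    exists [set h]; apply/seteqP; split=> z /=; first by move=> hz _ ->.
    by apply.
  move=> /(_ hZ) E; have : [set: X] x by [].
  by rewrite -E // => _ [g _ <-]; apply: hx.
have [y yZ] : exists y, ~ Defs.orbit a setT x0 y.
  apply: contrapT => ny; apply: nhom; exists x0; apply/seteqP; split=> // y _.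
  by apply: contrapT => yZ; apply: ny; exists y.
have stZ g x : ~ Defs.orbit a setT x0 x -> ~ Defs.orbit a setT x0 (a g x).
  move=> xZ [g' _ E]; apply: xZ; exists (g^-1 * g')%g => //.
  by rewrite actM E actK.
(* The complement of the orbit is the zero set of S and does not contain x0. *)
have [h [Sh hx0]] : exists h, S h /\ ev x0 h != 0.
  apply: contrapT => nS.
  have : (~` Defs.orbit a setT x0) x0.
    rewrite SE => h Sh; apply: contrapT => /eqP hx; apply: nS.
    by exists h.
  by apply; exists 1%g => //; rewrite act1.
have h0 : h != 0 by apply: contraNneq hx0 => ->; rewrite rmorph0.
have hZ x : ~ Defs.orbit a setT x0 x -> ev x h = 0.
  by move=> xZ; have : (~` Defs.orbit a setT x0) x by []; rewrite SE; apply.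
have [n [x1 [h1 [n_gt0 dx1 h1E]]]] :=
  boundary_monomial char0 dim1 dx0 stZ yZ h0 hZ.
have [f [f0 fE]] := monomial_degree_gcd nX n_gt0 dx1 h1E.
exists f, x1; split=> //; split=> // F; split=> [[h2 h2E]|].
  split=> [|_ x /mu_UbarP[z [s [z0 zf ->]]]].
    have -> : F = fun g => ev (a g x1) h2 by apply/funext.
    exact: orbit_map_kSL2.
  have stab s' z' : z' ^+ f = 1 -> a (lo s' * tor z')%g x1 = x1.
    exact: (monomial_stabilizer char0 dim1 n_gt0 dx1 h1E s' f0 fE).
  rewrite -!h2E !actM; congr (ev (a x _) h2).
  have := stab s 1; rewrite expr1n tor1 mulg1 => -> //.
  by have := stab 0 z zf; rewrite lo0 mul1g.
rewrite right_invariants_mu_Ubar // => -[P FP].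
have Sf : monomial_degree a x1 f by apply/fE.
have exB (i : 'I_f.+1) : exists h2, forall g,
    ev (a g x1) h2 = md g ^+ i * mb g ^+ (f - i).
  have [h2 h2E] := monomial_degree_polarize char0 Sf (ltnSE (ltn_ord i)).
  by exists h2 => g; rewrite h2E mulrC.
have [B BE] := choice exB.
(* The generators of [Rinf f] lift to the elements B of k[X], hence so does every polynomial P in
   them. *)
exists (mmap (in_alg (avcoord X)) B P) => g; rewrite FP mevalE.
rewrite /mmap rmorph_sum; apply: eq_bigr => m _.
rewrite (rmorphM (ev _)) [X in X * _]ev_alg; congr (_ * _).
rewrite /mmap1 rmorph_prod; apply: eq_bigr => i _.
by rewrite rmorphXn /= BE.
Qed.

(** Each g in the big cell is a lower triangular matrix times [wlo 0] times an element of [Ubar],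
    and right invariance drops the last factor. A function vanishing on the [Bbar]-orbit of [wlo 0]
    x thus vanishes on the image of the cell, hence on X. *)
Lemma model_spherical f x : normal_variety X -> model_at f x -> spherical a.
Proof.
move=> nX [dx xE]; split=> //; exists (a (wlo 0) x) => _ [S ->] DS.
apply/seteqP; split=> // y _ h Sh.
suff -> : h = 0 by apply: rmorph0.
have [_ Fi] := (xE (fun g => ev (a g x) h)).1 (ex_intro _ h (fun g => erefl)).
apply: dx => g; move: g; apply: kSL2_eq_mb => [||g b0].
- exact: orbit_map_kSL2.
- exact: generated_cst.
have z0 : (mb g)^-1 != 0 by rewrite invr_eq0.
rewrite (bruhat b0) -[ma g / mb g]add0r -wloD mulgA.
rewrite [LHS]Fi; last first.
  apply/mu_UbarP; exists 1, (ma g / mb g).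
  by rewrite oner_neq0 expr1n tor1 mul1g.
rewrite actM; apply: (DS _ _ h Sh).
exists (lo (md g / mb g) * tor (mb g)^-1)%g => //.
by rewrite /Bbar /= entriesM !torE // !loE; ring.
Qed.

Lemma model_isomorphic f x : model_at f x ->
  equivariantly_isomorphic a (@SL2_quotient_act k (@mu_Ubar k f)).
Proof.
move=> [dx xE]; pose R := right_invariant_ring (@mu_Ubar k f).
have ex_o h : exists r : R, forall g, val r g = ev (a g x) h.
  have [|r rE] := @right_invariant_lift _ (@mu_Ubar k f)
    (fun g => ev (a g x) h).
    by apply/xE; exists h.
  by exists r => g; rewrite rE.
have [o oE] := choice ex_o.
have ex_o' (r : R) : exists h, forall g, ev (a g x) h = val r g.
  by have /asboolP/(xE _).2 := valP r.
have [o' o'E] := choice ex_o'.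
have oK : cancel o o' by move=> h; apply: (orbit_eq dx) => g; rewrite o'E oE.
have o'K : cancel o' o.
  by move=> r; apply: val_inj; apply/funext => g; rewrite oE o'E.
have ex_phi y : exists xi : {lrmorphism R -> k^o}, forall r, xi r = ev y (o' r).
  apply: (lrmorphism_ex (phi := fun r => ev y (o' r))) => [c u v|].
    rewrite -[RHS]/(c * ev y (o' u) + ev y (o' v)) -evZ -rmorphD.
    congr (ev y _); apply: (orbit_eq dx) => g.
    by rewrite rmorphD /= evZ !o'E.
  split=> [|u v].
    rewrite -[RHS](rmorph1 (ev y)); congr (ev y _); apply: (orbit_eq dx) => g.
    by rewrite (rmorph1 (ev _)) o'E rmorph1.
  rewrite -[RHS]/(ev y (o' u) * ev y (o' v)) -rmorphM.
  congr (ev y _); apply: (orbit_eq dx) => g.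
  by rewrite rmorphM /= !o'E.
have [phi phiE] := choice ex_phi.
(* An algebra morphism on R, composed with [o], is one on k[X], hence a point of X. *)
have ex_psi (xi : {lrmorphism R -> k^o}) : exists y : X,
    forall h, ev y h = xi (o h).
  have [||eta etaE] := @lrmorphism_ex k (avcoord X) (fun h => xi (o h)).
  - move=> c u v; rewrite -linearP; congr (xi _); apply: val_inj.
    apply/funext => g; rewrite oE rmorphD /= evZ -!oE; reflexivity.
  - split=> [|u v].
      rewrite -(rmorph1 xi); congr (xi _); apply: val_inj; apply/funext => g.
      by rewrite oE rmorph1.
    rewrite -rmorphM; congr (xi _); apply: val_inj; apply/funext => g.
    by rewrite oE rmorphM /= -!oE.
  have [y [yE _]] := av_points eta.
  by exists y => h; rewrite -etaE -yE.
have [psi psiE] := choice ex_psi.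
exists phi, psi; split.
- by move=> y; apply: ev_point_inj => h; rewrite psiE phiE oK.
- by move=> xi; apply: lrmorphism_eq => r; rewrite phiE psiE o'K.
- by move=> r; exists (o' r) => y; rewrite /= phiE.
- by move=> h; exists (o h) => xi; rewrite /= -psiE.
- move=> g y; apply: lrmorphism_eq => r.
  rewrite phiE [RHS]phiE.
  have [h' h'E] := translate_ex a g (o' r).
  rewrite -h'E; congr (ev y _); apply: (orbit_eq dx) => g'.
  by rewrite h'E act_mul !o'E /= /left_translate invgK.
Qed.

(** The base point corresponds to evaluation at the identity of SL_2; by equivariance its translate
    by g corresponds to evaluation at g. *)
Lemma isomorphic_model f :
  equivariantly_isomorphic a (@SL2_quotient_act k (@mu_Ubar k f)) ->
  exists x, model_at f x.
Proof.
pose R := right_invariant_ring (@mu_Ubar k f).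
move=> [phi [psi [phiK psiK phiM psiM phiA]]].
have ex_pt g : exists xi : {lrmorphism R -> k^o}, forall r, xi r = val r g.
  exact: (lrmorphism_ex (phi := fun r : R => val r g)).
have [pt ptE] := choice ex_pt.
have ptA g : a g (psi (pt 1%g)) = psi (pt g).
  rewrite -[LHS]phiK phiA psiK; congr psi; apply: lrmorphism_eq => r.
  by rewrite /= !ptE /= /left_translate invgK mulg1.
exists (psi (pt 1%g)); split=> [h hx|F].
  apply: ev_inj => y; rewrite rmorph0; have [r rE] := psiM h.
  rewrite -(phiK y) /ev -rE; suff -> : r = 0 by apply: rmorph0.
  by apply: val_inj; apply/funext => g; rewrite -[RHS](hx g) -ptE ptA /ev -rE.
split=> [[h hE]|Fi].
  have [r rE] := psiM h; have -> : F = val r; last exact/asboolP/(valP r).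
  by apply/funext => g; rewrite -hE ptA -ptE /ev -rE.
have [r rE] := right_invariant_lift Fi.
have [h hE] := phiM r; exists h => g.
by rewrite ptA /ev hE psiK [LHS]ptE rE.
Qed.

(** The function h equal to b^f through x has weight f for the action, whatever the base point.
    Through x' it is invariant under [mu f'], which forces z^f = 1 whenever z^f' = 1. *)
Lemma model_degree_dvdn f f' x x' : (0 < f)%N -> (0 < f')%N ->
  model_at f x -> model_at f' x' -> (f' %| f)%N.
Proof.
move=> f0 f'0 [dx xE] [dx' x'E].
have [h hE] : exists h, forall g, ev (a g x) h = mb g ^+ f.
  apply/xE; rewrite right_invariants_mu_Ubar //.
  have := @Rinf_monomial k f f 0; rewrite addn0 dvdnn => /(_ isT).
  by congr (Rinf f _); apply/funext => g; rewrite expr0 mulr1.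
have [Uh wh] := wt_monomial_base dx hE.
have [_ Fi] := (x'E (fun g => ev (a g x') h)).1 (ex_intro _ h (fun g => erefl)).
(* Otherwise weight and right invariance make h vanish on the whole big cell through x'. *)
have hw : ev (a (wlo 0) x') h != 0.
  apply/eqP => hw; have h0 : h = 0.
    apply: dx' => g; move: g; apply: kSL2_eq_mb => [||g b0].
    - exact: orbit_map_kSL2.
    - exact: generated_cst.
    have z0 : (mb g)^-1 != 0 by rewrite invr_eq0.
    apply: (mulfI (expf_neq0 f z0)); rewrite mulr0.
    rewrite {2}(bruhat b0) !actM Uh wh // -[ma g / mb g]add0r -wloD.
    rewrite [LHS]Fi //; apply/mu_UbarP; exists 1, (ma g / mb g).
    by rewrite oner_neq0 expr1n tor1 mul1g.
  have := hE (wlo 0); rewrite h0 rmorph0 wloE expr1n => /esym/eqP.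
  by rewrite oner_eq0.
apply: unity_roots_dvdn => // z zf'; apply: (mulIf hw).
have z0 : z != 0.
  exact: unity_neq0 f'0 zf'.
have zi0 : z^-1 != 0 by rewrite invr_eq0.
(* Since [wlo 0] conjugates [tor z] to its inverse, the right action of z on h becomes a left one,
   which is governed by the weight. *)
have E : ev (a (tor z^-1) (a (wlo 0) x')) h = ev (a (wlo 0) x') h.
  rewrite -actM; have -> : (tor z^-1 * wlo 0)%g = (wlo 0 * tor z)%g.
    by apply: SL2P; rewrite !entriesM !wloE !torE //; field;
      rewrite ?z0 ?oner_neq0.
  by apply: Fi; apply/mu_UbarP; exists z, 0; rewrite lo0 mulg1.
have := wh z^-1 (a (wlo 0) x') zi0; rewrite E exprVn => W.
by rewrite mul1r -{1}W mulrA mulfV ?expf_neq0 // mul1r.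
Qed.

End QuotientModel.

Theorem proposition5p2 (k : closedFieldType) (X : affineVariety k)
    (a : SL2_action X) :
  [pchar k] =i pred0 ->
  normal_variety X ->
  has_open_dense_orbit a ->
  ~ homogeneous a ->
  has_krull_dim (invariant_ring a (@Ubar k)) 1 ->
  [/\ spherical a,
      forall f, (0 < f)%N -> right_invariants (@mu_Ubar k f) = Rinf f &
      exists! f : nat, (0 < f)%N /\
        equivariantly_isomorphic a (@SL2_quotient_act k (@mu_Ubar k f))].
Proof.
move=> char0 nX od nhom dim1.
have [f [x [f0 fx]]] := model_ex char0 nX od nhom dim1.
split; [exact: model_spherical nX fx | exact: right_invariants_mu_Ubar |].
exists f; split; first by split=> //; apply: model_isomorphic fx.
move=> f' [f'0 /isomorphic_model[x' f'x']]; apply/eqP; rewrite eqn_dvd.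
by rewrite (model_degree_dvdn char0 f'0 f0 f'x' fx)
  (model_degree_dvdn char0 f0 f'0 fx f'x').
Qed.
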